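(* There exist universal constants $C',C''>0$ such that the following holds. Let $1<p<2$ and let $\Omega\subset\mathbb{R}^2$ be a bounded simply-connected $W^{1,p}$-extension domain. Let $C>0$ be a constant such that every $z_1,z_2\in\mathbb{R}^2\setminus\Omega$ can be joined by a rectifiable curve $\gamma\subset\mathbb{R}^2\setminus\Omega$ satisfying $$\int_{\gamma}\mathrm{dist}(z,\partial\Omega)^{1-p}\,\mathrm{d}s(z)\le C\|z_1-z_2\|^{2-p}.$$ Then $\partial\Omega$ is weakly mean porous with parameters $(\alpha,\lambda)$, where $\lambda(k)=C'C$ for all $k\in\mathbb{Z}^+$ and $\alpha(t)=\frac{C''}{C}t$ for all $t\in(0,1)$.
   Context: A domain $\Omega\subset\mathbb{R}^d$ is a (Sobolev) $W^{1,p}$-extension domain if there exists a constant $K\in(1,\infty)$ such that for every $f\in W^{1,p}(\Omega)$ there exists $F\in W^{1,p}(\mathbb{R}^d)$ with $F|_\Omega=f$ and $\|F\|_{W^{1,p}(\mathbb{R}^d)}\le K\|f\|_{W^{1,p}(\Omega)}$. Here $\mathrm{d}s$ is integration with respect to arc length, and $\mathrm{dist}(z,\partial\Omega)^{1-p}$ is understood as $+\infty$ when $z\in\partial\Omega$. Cubes are open with sides parallel to the coordinate axes, and $\ell(Q)$ denotes the side-length of a cube $Q$. $B(x,r)$ is the ball of radius $r$ centered at $x$. Weak mean porosity: let $E\subset\mathbb{R}^d$ be compact, let $\alpha:(0,1)\to(0,1)$ be a continuous function such that $\alpha(t)/t$ is increasing (in the non-strict sense, i.e. non-decreasing) in $t$,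 and let $\lambda:\mathbb{Z}^+\to\mathbb{R}$ be a function. For a collection $\mathcal{D}$ of pairwise disjoint open cubes contained in $\mathbb{R}^d\setminus E$, $x\in E$ and $k\in\mathbb{Z}^+$, put $A_k(x)=B(x,2^{-k})\setminus B(x,2^{-k-1})$, let $\chi_k^{\mathcal D}(x)=1$ if there exist at least $\lambda(k)$ cubes $Q\in\mathcal{D}$ with $Q\subset A_k(x)$ and $\ell(Q)\ge\alpha(2^{-k})$, and $\chi_k^{\mathcal D}(x)=0$ otherwise. Let $S_j^{\mathcal D}(x)=\sum_{k=1}^{j}\chi_k^{\mathcal D}(x)$. The set $E$ is weakly mean porous with parameters $(\alpha,\lambda)$ if there exist such a collection $\mathcal{D}$ and $j_0\in\mathbb{Z}^+$ such that $\frac{S_j^{\mathcal D}(x)}{j}>\frac12$ for all $x\in E$ and all $j\ge j_0$. *)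

(* Defs.v *)
From HB Require Import structures.
From mathcomp Require Import all_boot all_order all_algebra.
From mathcomp Require Import all_classical all_reals all_analysis.

Set Implicit Arguments.
Unset Strict Implicit.
Unset Printing Implicit Defensive.

Import Order.TTheory GRing.Theory Num.Theory.
Import numFieldNormedType.Exports.

Local Open Scope classical_set_scope.
Local Open Scope ring_scope.

Section euclidean_plane.
Context {R : realType}.
Implicit Types (x y z : R * R) (A E : set (R * R)).

(* The library norm on [R * R] is the max norm: it induces the usual topology
   and the usual bounded sets, but every metric quantity below (balls,
   distances, lengths, norms of gradients) is Euclidean. *)
Definition enorm z : R := Num.sqrt (z.1 ^+ 2 + z.2 ^+ 2).

Definition eball x (r : R) : set (R * R) := [set y | enorm (y - x) < r].

Definition dist_set z A : R := inf [set enorm (z - w) | w in A].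

Definition boundary A : set (R * R) := closure A `\` A°.

(* [measurableTypeR R] is R with its Borel sigma-algebra, on which
   [lebesgue_measure] is defined. *)
Definition leb2 :
    {measure set (measurableTypeR R * measurableTypeR R) -> \bar R} :=
  (@lebesgue_measure R \x @lebesgue_measure R)%E.

End euclidean_plane.

Section domains.
Context {R : realType}.
Implicit Types (Omega : set (R * R)).

Definition domain Omega : Prop :=
  [/\ Omega !=set0, open Omega & connected Omega].

(* Triviality of the fundamental group at every base point; for a domain
   path-connectedness is automatic. *)
Definition simply_connected Omega : Prop :=
  connected Omega /\
  forall c : R -> R * R,
    {within `[0, 1], continuous c} -> c @` `[0, 1] `<=` Omega -> c 0 = c 1 ->
    exists H : R * R -> R * R,
      [/\ {within `[0, 1] `*` `[0, 1], continuous H},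
          H @` (`[0, 1] `*` `[0, 1]) `<=` Omega,
          forall t, t \in `[0, 1] -> H (t, 0) = c t,
          forall t, t \in `[0, 1] -> H (t, 1) = c 0 &
          forall s, s \in `[0, 1] -> H (0, s) = c 0 /\ H (1, s) = c 0].

End domains.

Section sobolev.
Context {R : realType}.
Implicit Types (Omega : set (R * R)) (p : R)
  (f h phi : R * R -> R) (g : R * R -> R * R).

Definition e1 : R * R := (1, 0).
Definition e2 : R * R := (0, 1).

Fixpoint Ck (n : nat) phi : Prop :=
  continuous phi /\
  if n is m.+1 then
    forall v : R * R, v = e1 \/ v = e2 ->
      (forall x, derivable phi x v) /\ Ck m ('D_v phi)
  else True.

Definition test_function Omega phi : Prop :=
  let K := closure [set x | phi x != 0] in
  [/\ forall n, Ck n phi, compact K & K `<=` Omega].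

Definition weak_partial Omega (v : R * R) f h : Prop :=
  forall phi, test_function Omega phi ->
    \int[leb2]_(x in Omega) (f x * 'D_v phi x) =
    - \int[leb2]_(x in Omega) (h x * phi x).

Definition Lp_norm Omega p f : \bar R :=
  'N[leb2]_p%:E[(EFin \o f) \_ Omega].

Definition in_Lp Omega p f : Prop :=
  measurable_fun (Omega : set (measurableTypeR R * measurableTypeR R)) f /\
  (Lp_norm Omega p f < +oo)%E.

(* [sobolev Omega p f g]: f is in W^{1,p}(Omega), with weak gradient g. The
   gradient, unique up to a null set, is kept as an explicit argument. *)
Definition sobolev Omega p f g : Prop :=
  [/\ in_Lp Omega p f,
      in_Lp Omega p (fst \o g) /\ in_Lp Omega p (snd \o g),
      weak_partial Omega e1 f (fst \o g) &
      weak_partial Omega e2 f (snd \o g)].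

Definition sobolev_norm Omega p f g : \bar R :=
  (Lp_norm Omega p f + Lp_norm Omega p (enorm \o g))%E.

Definition sobolev_extension_domain Omega p : Prop :=
  domain Omega /\
  exists K : R, 1 < K /\
    forall f g, sobolev Omega p f g ->
      exists F G,
        [/\ sobolev setT p F G,
            {ae leb2, forall x, Omega x -> F x = f x} &
            (sobolev_norm setT p F G <= K%:E * sobolev_norm Omega p f g)%E].

End sobolev.

Section curves.
Context {R : realType}.
Implicit Types (c : R -> R * R) (h : R * R -> \bar R).

Definition curve_length c (a b : R) : \bar R :=
  ereal_sup [set (\sum_(0 <= i < size s)
       enorm (c (nth b (a :: s) i.+1) - c (nth b (a :: s) i)))%:E
     | s in itv_partition a b].

Definition rectifiable_curve c (A : set (R * R)) (z1 z2 : R * R) : Prop :=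
  [/\ {within `[0, 1], continuous c},
      c @` `[0, 1] `<=` A,
      c 0 = z1, c 1 = z2 &
      (curve_length c 0 1 < +oo)%E].

(* [arc_length_param c s] is the point of c at arc length s from c 0. It does
   not depend on the chosen parameter: two parameters with the same value of
   the length function bound an interval on which c is constant. *)
Definition arc_length_param c (s : R) : R * R :=
  c (xget 0 [set t | t \in `[0, 1] /\ curve_length c 0 t = s%:E]).

Definition line_integral c h : \bar R :=
  (\int[lebesgue_measure]_(s in `[0%R, fine (curve_length c 0 1)])
     h (arc_length_param c s))%E.

Definition dist_weight (Omega : set (R * R)) (p : R) (z : R * R) : \bar R :=
  if `[< boundary Omega z >] then +oo%E
  else (dist_set z (boundary Omega) `^ (1 - p))%:E.

Definition curve_condition (Omega : set (R * R)) (p C : R) : Prop :=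
  forall z1 z2, ~ Omega z1 -> ~ Omega z2 ->
    exists c, rectifiable_curve c (~` Omega) z1 z2 /\
      (line_integral c (dist_weight Omega p)
         <= (C * enorm (z1 - z2) `^ (2 - p))%:E)%E.

End curves.

Section weak_mean_porosity.
Context {R : realType}.

Record cube := Cube { corner : R * R; side : R; side_gt0 : 0 < side }.

Definition cube_set (Q : cube) : set (R * R) :=
  [set y | (corner Q).1 < y.1 < (corner Q).1 + side Q /\
           (corner Q).2 < y.2 < (corner Q).2 + side Q].

Implicit Types (E : set (R * R)) (D : set cube) (x : R * R)
  (alpha : R -> R) (lambda : nat -> R).

Definition annulus x (k : nat) : set (R * R) :=
  eball x (2 ^- k) `\` eball x (2 ^- k.+1).

Definition good_cubes D alpha x (k : nat) : set cube :=
  [set Q | [/\ D Q, cube_set Q `<=` annulus x k & alpha (2 ^- k) <= side Q]].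

Definition porous_scale D alpha lambda x (k : nat) : Prop :=
  exists n : nat, lambda k <= n%:R /\ (`I_n #<= good_cubes D alpha x k)%card.

Definition chi D alpha lambda x (k : nat) : nat :=
  `[< porous_scale D alpha lambda x k >].

Definition porosity_sum D alpha lambda x (j : nat) : nat :=
  (\sum_(1 <= k < j.+1) chi D alpha lambda x k)%N.

Definition admissible alpha : Prop :=
  [/\ forall t, 0 < t < 1 -> 0 < alpha t < 1,
      {within `]0, 1[, continuous alpha} &
      forall s t, 0 < s -> s <= t -> t < 1 -> alpha s / s <= alpha t / t].

(* The values of [lambda] at 0 and of [alpha] outside ]0, 1[ are never used. *)
Definition weakly_mean_porous E alpha lambda : Prop :=
  [/\ compact E, admissible alpha &
      exists (D : set cube) (j0 : nat),
        [/\ trivIset D cube_set,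
            forall Q, D Q -> cube_set Q `<=` ~` E,
            (0 < j0)%N &
            forall x j, E x -> (j0 <= j)%N ->
              2^-1 < (porosity_sum D alpha lambda x j)%:R / j%:R :> R]].

End weak_mean_porosity.

(* Main.v *)
Require Import Defs.
From mathcomp Require Import all_boot all_order all_algebra.
From mathcomp Require Import all_classical all_reals all_analysis.
From mathcomp Require Import lra ring zify.
Import Order.TTheory GRing.Theory Num.Theory.
Import numFieldNormedType.Exports.
Local Open Scope classical_set_scope.
Local Open Scope ring_scope.

(** Why the theorem holds. Fix a boundary point [x] and a scale [r = 2 ^- k] small compared
    with [Omega]. As [Omega] is connected, and has points close to [x] as well as points
    at distance more than [r] from [x], no loop in the complement of [Omega] goes once
    around [x] inside the annulus of radii [r / 2] and [r] (lemma [loop_separates]). Such a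
    loop exists, however, if the annulus contains at most [C] cubes of side [s], of order
    [r / C], of the collection. For then each coordinate of a point well inside the annulus that is
    farther than [42 s] from the boundary is within [s] of the same coordinate of the
    corner of one of these cubes (lemma [good_subcube_shadow]). The max-distance from such
    points to a given point thus takes few values, so there is a whole square centred
    at [x] whose points are all within [42 s] of the boundary (lemma [near_square]). Go
    around this square in steps of length at most [s], and replace each point by a nearby
    boundary point. Two consecutive boundary points are joined by a curve as in the
    hypothesis, with weighted length at most [C * (128 s) ^ (2 - p)]. The weight is at
    least [(128 s) ^ (1 - p)] within [128 s] of the boundary, so this curve spends there at
    most the length [128 C s], a small fraction of [r]; elsewhere, its max-distance to its
    starting point takes few values. Hence it stays close to its starting point (lemma
    [curve_stays_near]), and together these curves go around [x].

    The argument treats one scale at a time, so all scales below the size of [Omega]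
    are porous, and the proportion of porous scales tends to one.

    One collection of cubes has to serve all points and all scales. A large Whitney
    cell of the complement of the boundary, of side [l], must provide, at each scale
    [r >= l], about [l / s] cubes of side [s]; cutting the cell into equal cubes works for
    one scale only. Since only the lengths of the projections matter, it suffices to take
    for each [s = 2 ^- M] smaller than [l] the cubes of side [s] in an L-shaped layer of
    thickness [s] along two sides of the cell. Placing this layer at distance [s] from the
    two sides makes the layers for distinct [s] disjoint (definition [whitney_subcube]).

    The separation property is proved with the parity of the number of crossings of a
    vertical ray with a closed chain of points, which does not change as long as the
    origin of the ray stays away from the chain (lemma [crossing_parity_move]). The side of the
    cubes must not exceed [r], for which [C >= 1] is needed: this follows from the curve
    condition at a boundary point (lemma [curve_constant_ge1]). *)

Set Implicit Arguments.
Unset Strict Implicit.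
Unset Printing Implicit Defensive.

(** * Norms of the plane and lengths of curves *)

Section plane_norms.
Context {R : realType}.
Implicit Types (x y z : R * R).

Lemma normr_pair_le z (d : R) :
  (`|z| <= d) = (`|z.1| <= d) && (`|z.2| <= d).
Proof. by rewrite prod_normE ge_max. Qed.

Lemma normr_pair_lt z (d : R) :
  (`|z| < d) = (`|z.1| < d) && (`|z.2| < d).
Proof. by rewrite prod_normE gt_max. Qed.

Lemma sqr_enorm z : enorm z ^+ 2 = z.1 ^+ 2 + z.2 ^+ 2.
Proof. by rewrite sqr_sqrtr// addr_ge0// sqr_ge0. Qed.

Lemma enorm_ge0 z : 0 <= enorm z.
Proof. exact: sqrtr_ge0. Qed.

Lemma enormN z : enorm (- z) = enorm z.
Proof. by rewrite /enorm /= !sqrrN. Qed.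

Lemma enorm0 : enorm (0 : R * R) = 0.
Proof. by rewrite /enorm/= expr0n/= addr0 sqrtr0. Qed.

Lemma enorm_distC x y : enorm (x - y) = enorm (y - x).
Proof. by rewrite -enormN opprB. Qed.

Lemma le_normr_enorm z : `|z| <= enorm z.
Proof.
have sq t : `|t| = Num.sqrt (t ^+ 2) :> R by rewrite sqrtr_sqr.
rewrite normr_pair_le !sq /enorm !ler_wsqrtr//.
  by rewrite lerDr sqr_ge0.
by rewrite lerDl sqr_ge0.
Qed.

Lemma fst_le_enorm z : `|z.1| <= enorm z.
Proof. by apply: le_trans (le_normr_enorm z); rewrite prod_normE le_max lexx. Qed.

Lemma snd_le_enorm z : `|z.2| <= enorm z.
Proof. by apply: le_trans (le_normr_enorm z); rewrite prod_normE le_max lexx orbT. Qed.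

(** The rational [3 / 2] stands for the square root of 2. It is small enough for
    a point at max-distance [(61 / 100 + 61 / 2000) r] to be at Euclidean distance less
    than [r], as the inclusion of cubes in annuli requires below. *)
Lemma enorm_le_normr z : enorm z <= 3 / 2 * `|z|.
Proof.
have : `|z| <= `|z| by [].
rewrite normr_pair_le => /andP[z1 z2].
have z0 := normr_ge0 z.
rewrite -(@ler_pXn2r _ 2)// ?nnegrE ?enorm_ge0 ?mulr_ge0// sqr_enorm.
have h1 : z.1 ^+ 2 <= `|z| ^+ 2 by rewrite -real_normK ?num_real// ler_pXn2r// nnegrE.
have h2 : z.2 ^+ 2 <= `|z| ^+ 2 by rewrite -real_normK ?num_real// ler_pXn2r// nnegrE.
have h3 : 0 <= `|z| ^+ 2 by exact: sqr_ge0.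
by rewrite exprMn; lra.
Qed.

Lemma enorm_le_coord_sum z : enorm z <= `|z.1| + `|z.2|.
Proof.
rewrite -(@ler_pXn2r _ 2)// ?nnegrE ?addr_ge0 ?enorm_ge0// sqr_enorm [leRHS]sqrrD.
rewrite !real_normK ?num_real//.
have : 0 <= `|z.1| * `|z.2| by rewrite mulr_ge0.
lra.
Qed.

Lemma ler_enormD x y : enorm (x + y) <= enorm x + enorm y.
Proof.
have x0 := enorm_ge0 x; have y0 := enorm_ge0 y.
rewrite -(@ler_pXn2r _ 2)// ?nnegrE ?addr_ge0 ?enorm_ge0// [leRHS]sqrrD !sqr_enorm/=.
suff : x.1 * y.1 + x.2 * y.2 <= enorm x * enorm y by move=> h; lra.
apply: (le_trans (ler_norm _)).
rewrite -(@ler_pXn2r _ 2)// ?nnegrE ?mulr_ge0//.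
rewrite real_normK ?num_real// exprMn !sqr_enorm.
have := sqr_ge0 (x.1 * y.2 - x.2 * y.1); nra.
Qed.

Lemma ler_enorm_dist x y z : enorm (x - z) <= enorm (x - y) + enorm (y - z).
Proof. by rewrite -(subrKA y) ler_enormD. Qed.

End plane_norms.

Section arc_length.
Context {R : realType}.
Variable c : R -> R * R.
Implicit Types (a b m t : R) (s : seq R).

(** Recursion on the partition replaces the indexed sum in [curve_length],
    so that concatenating and splitting partitions is immediate. *)
Fixpoint polygon_length a s : R :=
  if s is h :: s' then enorm (c h - c a) + polygon_length h s' else 0.

Lemma polygon_lengthE a b s :
  \sum_(0 <= i < size s) enorm (c (nth b (a :: s) i.+1) - c (nth b (a :: s) i)) =
  polygon_length a s.
Proof.
elim: s a => [|h s ih] a; first by rewrite big_nil.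
by rewrite /= big_nat_recl//= -ih.
Qed.

Lemma polygon_le_length a b s : itv_partition a b s ->
  ((polygon_length a s)%:E <= curve_length c a b)%E.
Proof.
by move=> abs; apply: ereal_sup_ubound; exists s => //; rewrite polygon_lengthE.
Qed.

Lemma length_le a b (l : \bar R) :
  (forall s, itv_partition a b s -> ((polygon_length a s)%:E <= l)%E) ->
  (curve_length c a b <= l)%E.
Proof.
by move=> h; apply: ge_ereal_sup => _ [s abs <-]; rewrite polygon_lengthE h.
Qed.

Lemma curve_lengthxx a : curve_length c a a = 0%E.
Proof.
apply/eqP; rewrite eq_le; apply/andP; split.
  by apply: length_le => s /itv_partitionxx ->.
by apply: (@polygon_le_length a a [::]); split => /=.
Qed.

Lemma dist_le_length a b : a <= b ->
  ((enorm (c b - c a))%:E <= curve_length c a b)%E.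
Proof.
rewrite le_eqVlt => /predU1P[->|ab]; first by rewrite subrr enorm0 curve_lengthxx.
by have := polygon_le_length (itv_partition1 ab); rewrite /= addr0.
Qed.

Lemma curve_length_ge0 a b : a <= b -> (0 <= curve_length c a b)%E.
Proof. by move=> ab; apply: le_trans (dist_le_length ab); rewrite lee_fin enorm_ge0. Qed.

Lemma polygon_length_cat a s s' :
  polygon_length a (s ++ s') = polygon_length a s + polygon_length (last a s) s'.
Proof. by elim: s a => [|h s ih] a /=; rewrite ?add0r// ih addrA. Qed.

Lemma length_superadd_dist_l a m b : a <= m -> m <= b ->
  ((enorm (c m - c a))%:E + curve_length c m b <= curve_length c a b)%E.
Proof.
rewrite le_eqVlt => /predU1P[->|am] mb; first by rewrite subrr enorm0 add0e.
rewrite addeC -leeBrDr//; apply: length_le => s [ps ls].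
rewrite leeBrDr//; have /polygon_le_length : itv_partition a b (m :: s).
  by split => //=; rewrite am.
by rewrite /= EFinD addeC.
Qed.

Lemma length_superadd_dist_r a m b : a <= m -> m <= b ->
  (curve_length c a m + (enorm (c b - c m))%:E <= curve_length c a b)%E.
Proof.
move=> am; rewrite le_eqVlt => /predU1P[->|mb]; first by rewrite subrr enorm0 adde0.
rewrite -leeBrDr//; apply: length_le => s ps.
rewrite leeBrDr//; have /polygon_le_length := itv_partition_cat ps (itv_partition1 mb).
by rewrite polygon_length_cat/=; case: ps => _ /eqP ->; rewrite addr0 EFinD.
Qed.

(** Inserting the point [m] into a partition only lengthens the polygon. *)
Lemma length_subadd a m b : a <= m -> m <= b ->
  (curve_length c a b <= curve_length c a m + curve_length c m b)%E.
Proof.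
move=> am mb; apply: length_le => s; elim: s a am => [|h s ih] a am /=.
  by move=> _; rewrite adde_ge0 ?curve_length_ge0.
move=> [/= /andP[ah hs] lb]; have [mh|hm] := leP m h.
  apply: (@le_trans _ _ ((enorm (c m - c a))%:E +
                         (enorm (c h - c m) + polygon_length h s)%:E)%E).
    by rewrite -EFinD lee_fin; have := ler_enorm_dist (c h) (c m) (c a); lra.
  apply: leeD; first exact: dist_le_length.
  move: mh; rewrite le_eqVlt => /predU1P[->|mh].
    by rewrite subrr enorm0 add0r polygon_le_length//; split.
  by apply: (@polygon_le_length _ _ (h :: s)); split => //=; rewrite mh.
apply: (@le_trans _ _ ((enorm (c h - c a))%:E +
                       (curve_length c h m + curve_length c m b))%E).
  by rewrite EFinD; apply: leeD => //; apply: ih; [exact: ltW|split].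
by rewrite addeA; apply: leeD => //; apply: length_superadd_dist_l; exact: ltW.
Qed.

(** With [bounded_variation_coord], this reduces the continuity of the
    length function to the continuity of the total variation of the coordinates. *)
Lemma length_le_variations a b :
  (curve_length c a b <=
   total_variation a b (fst \o c) + total_variation a b (snd \o c))%E.
Proof.
apply: length_le => s abs.
apply: (@le_trans _ _ ((variation a b (fst \o c) s)%:E +
                       (variation a b (snd \o c) s)%:E)%E).
  rewrite -EFinD lee_fin -(polygon_lengthE a b) /variation -big_split/=.
  apply: ler_sum => i _; set z := (c _ - c _).
  exact: enorm_le_coord_sum.
apply: leeD; apply: ereal_sup_ubound.
  by exists (variation a b (fst \o c) s) => //; exists s.
by exists (variation a b (snd \o c) s) => //; exists s.
Qed.

Lemma bounded_variation_coord (f : R * R -> R) a b : a <= b ->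
  (forall z w, `|f z - f w| <= enorm (z - w)) ->
  (curve_length c a b < +oo)%E -> bounded_variation a b (f \o c).
Proof.
move=> ab fle; have := curve_length_ge0 ab.
case: (curve_length c a b) (@polygon_le_length a b) => // l Hl l0 _.
exists l => _ [s abs <-].
apply: (@le_trans _ _ (polygon_length a s)); last by rewrite -lee_fin Hl.
rewrite -(polygon_lengthE a b) /variation; apply: ler_sum => i _; exact: fle.
Qed.

End arc_length.

Section arc_length_parametrization.
Context {R : realType}.
Variable c : R -> R * R.
Hypothesis cc : {within `[0, 1], continuous c}.
Hypothesis lc : (curve_length c 0 1 < +oo)%E.
Implicit Types (s t : R).

Let L := fine (curve_length c 0 1).
Let len t := fine (curve_length c 0 t).
Let gam := arc_length_param c.

Lemma curve_length_initial t : 0 <= t -> t <= 1 ->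
  curve_length c 0 t = (fine (curve_length c 0 t))%:E.
Proof.
move=> t0 t1; rewrite fineK// ge0_fin_numE ?curve_length_ge0//.
apply: le_lt_trans lc; apply: le_trans (length_superadd_dist_r c t0 t1).
by rewrite leeDl// lee_fin enorm_ge0.
Qed.

Lemma dist_le_length_diff t t' : 0 <= t -> t <= t' -> t' <= 1 ->
  enorm (c t' - c t) <= len t' - len t.
Proof.
move=> t0 tt' t1; have := length_superadd_dist_r c t0 tt'.
rewrite (curve_length_initial (le_trans t0 tt') t1).
rewrite (curve_length_initial t0 (le_trans tt' t1)).
by rewrite -EFinD lee_fin /len => h; lra.
Qed.

Lemma length_nondecreasing t t' : 0 <= t -> t <= t' -> t' <= 1 -> len t <= len t'.
Proof.
move=> t0 tt' t1; have := dist_le_length_diff t0 tt' t1.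
by have := enorm_ge0 (c t' - c t); lra.
Qed.

Let tvar (f : R * R -> R) t := fine (total_variation 0 t (f \o c)).

(** The increment of the length is the length of the arc in between, which
    the variations of the two coordinates on that arc dominate. *)
Lemma length_diff_le_variation t t' : 0 <= t -> t <= t' -> t' <= 1 ->
  len t' - len t <= (tvar fst t' - tvar fst t) + (tvar snd t' - tvar snd t).
Proof.
move=> t0 tt' t1; have t'0 := le_trans t0 tt'; have t1' := le_trans tt' t1.
have BV (f : R * R -> R) : (forall z w, `|f z - f w| <= enorm (z - w)) ->
    [/\ total_variation 0 t (f \o c) = (tvar f t)%:E,
        total_variation 0 t' (f \o c) = (tvar f t')%:E &
        total_variation t t' (f \o c) = (tvar f t' - tvar f t)%:E].
  move=> fle; have bv := bounded_variation_coord ler01 fle lc.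
  have fint u : 0 <= u -> u <= 1 -> total_variation 0 u (f \o c) = (tvar f u)%:E.
    move=> u0 u1; rewrite /tvar fineK//; apply/bounded_variationP => //.
    exact: bounded_variationl u1 bv.
  split; [exact: fint|exact: fint|].
  have := total_variationD (f \o c) t0 tt'; rewrite !fint// => E.
  have fin : total_variation t t' (f \o c) \is a fin_num.
    rewrite ge0_fin_numE ?total_variation_ge0// ltey; apply/eqP => h.
    by move: E; rewrite h.
  by move: E; rewrite -(fineK fin) -EFinD => -[->]; congr EFin; ring.
have [|_ _ E1] := BV fst.
  by move=> z w; exact: fst_le_enorm (z - w).
have [|_ _ E2] := BV snd.
  by move=> z w; exact: snd_le_enorm (z - w).
have := length_subadd c t0 tt'.
have := length_le_variations c t t'; rewrite E1 E2.
rewrite (curve_length_initial t'0 t1) (curve_length_initial t0 t1').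
have : (0 <= curve_length c t t')%E by exact: curve_length_ge0.
case: (curve_length c t t') => // l _; rewrite -!EFinD !lee_fin.
by rewrite /len => h1 h2; lra.
Qed.

Let squeeze_increment (u u' g g' h h' e : R) :
  u <= u' -> u' - u <= (g' - g) + (h' - h) ->
  `|g - g'| < e / 2 -> `|h - h'| < e / 2 -> `|u - u'| < e.
Proof.
by rewrite !ltr_norml => ? ? /andP[? ?] /andP[? ?]; apply/andP; split; lra.
Qed.

Lemma length_continuous : {within `[0, 1], continuous len}.
Proof.
have ct (f : R * R -> R) : (forall z w, `|f z - f w| <= enorm (z - w)) ->
    continuous f -> {within `[0, 1], continuous (tvar f)}.
  move=> fle fc; apply: total_variation_continuous => //.
    apply/subspace_continuousP => x x01.
    have h := (proj1 (subspace_continuousP _ _) cc) x x01. 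
    have h2 := fc (c x).
    exact: (cvg_comp _ _ h h2).
  exact: bounded_variation_coord.
have c1 : {within `[0, 1], continuous (tvar fst)}.
  apply: ct; last by move=> z; exact: cvg_fst.
  by move=> z w; exact: fst_le_enorm (z - w).
have c2 : {within `[0, 1], continuous (tvar snd)}.
  apply: ct; last by move=> z; exact: cvg_snd.
  by move=> z w; exact: snd_le_enorm (z - w).
apply/subspace_continuousP => x x01; apply/cvgrPdist_lt => e e0.
have e20 : 0 < e / 2 by rewrite divr_gt0.
move/subspace_continuousP/(_ _ x01)/cvgrPdist_lt/(_ _ e20) : c1.
move/subspace_continuousP/(_ _ x01)/cvgrPdist_lt/(_ _ e20) : c2.
rewrite !near_withinE; apply: filterS2 => y h2 h1 y01.
move: (h1 y01) (h2 y01); move: x01 y01.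
rewrite /from_subspace /= !in_itv/= => /andP[x0 x1] /andP[y0 y1] d1 d2.
have [xy|/ltW yx] := leP x y.
  apply: (squeeze_increment (length_nondecreasing x0 xy y1)) d1 d2.
  exact: length_diff_le_variation.
rewrite distrC; rewrite distrC in d1; rewrite distrC in d2.
apply: (squeeze_increment (length_nondecreasing y0 yx x1)) d1 d2.
exact: length_diff_le_variation.
Qed.

Lemma arc_length_paramK t : 0 <= t -> t <= 1 -> gam (len t) = c t.
Proof.
move=> t0 t1; rewrite /gam /arc_length_param.
case: xgetP => [u _ [/itvP u01 Eu]|/(_ t)]; last first.
  by case; split; [rewrite in_itv/= t0|rewrite curve_length_initial].
have u0 : 0 <= u by rewrite u01.
have u1 : u <= 1 by rewrite u01.
have El : len u = len t by rewrite /len Eu.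
apply/eqP; rewrite -subr_eq0 -normr_le0; apply: le_trans (le_normr_enorm _) _.
have [tu|/ltW ut] := leP t u.
  by have := dist_le_length_diff t0 tu u1; rewrite El subrr.
by rewrite enorm_distC; have := dist_le_length_diff u0 ut t1; rewrite El subrr.
Qed.

(** Every arc-length parameter is attained, so that [arc_length_param] never
    takes the default value of its choice operator between 0 and the total length. *)
Lemma length_surjective s : 0 <= s -> s <= L ->
  exists t, [/\ 0 <= t, t <= 1 & len t = s].
Proof.
move=> s0 sL; have l0 : len 0 = 0 by rewrite /len curve_lengthxx.
have [|t] := IVT ler01 length_continuous (v := s).
  by rewrite l0 -/L (min_idPl _) ?(max_idPr _) ?s0//; exact: le_trans sL.
by rewrite in_itv/= => /andP[t0 t1] <-; exists t.
Qed.

Lemma arc_length_param_lipschitz s s' : 0 <= s -> s <= L -> 0 <= s' -> s' <= L ->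
  enorm (gam s - gam s') <= `|s - s'|.
Proof.
move=> s0 sL s'0 s'L.
have [t [t0 t1 <-]] := length_surjective s0 sL.
have [u [u0 u1 <-]] := length_surjective s'0 s'L.
rewrite !arc_length_paramK//; have [tu|/ltW ut] := leP t u.
  rewrite enorm_distC distrC; apply: le_trans (ler_norm _).
  exact: dist_le_length_diff.
by apply: le_trans (ler_norm _); exact: dist_le_length_diff.
Qed.

End arc_length_parametrization.

(** * Lebesgue outer measure and integrals *)

Section lebesgue_outer_measure.
Context {R : realType}.
Local Notation mu := (@lebesgue_measure R).
Implicit Types (F T : set R) (f : R -> R).

Let outer : {outer_measure set (ocitv_type R) -> \bar R} :=
  mu_ext (wlength (@idfun R)).

Lemma le_lebesgue_outer F T : F `<=` T -> (mu F <= mu T)%E.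
Proof. exact: (le_outer_measure outer). Qed.

Lemma lebesgue_outer_ge0 F : (0 <= mu F)%E.
Proof. exact: (outer_measure_ge0 outer). Qed.

Lemma lebesgue_outerU F T : (mu (F `|` T) <= mu F + mu T)%E.
Proof. exact: (outer_measureU2 outer). Qed.

(** Here and below the measure is evaluated on sets that need not be measurable,
    where it is the outer measure. *)
Lemma lebesgue_outer_diam F (d : R) : 0 <= d ->
  (forall x y, F x -> F y -> x - y <= d) -> (mu F <= d%:E)%E.
Proof.
move=> d0 diam; have [->|/set0P[x0 Fx0]] := eqVneq F set0.
  by rewrite measure0.
have hs : has_sup F.
  by split; [exists x0|exists (x0 + d) => y Fy; have := diam y x0 Fy Fx0; lra].
have hi : has_inf F.
  by split; [exists x0|exists (x0 - d) => y Fy; have := diam x0 y Fx0 Fy; lra].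
have sle : sup F - d <= inf F.
  apply: lb_le_inf; first by exists x0.
  move=> y Fy; rewrite lerBlDr; apply: ge_sup; first by exists x0.
  by move=> z Fz; have := diam z y Fz Fy; lra.
apply: (@le_trans _ _ (mu `[inf F, sup F])).
  apply: le_lebesgue_outer => y Fy /=; rewrite in_itv/=.
  by rewrite ge_inf ?ub_le_sup//; [case: hs|case: hi].
rewrite lebesgue_measure_itv/=; case: ifP => _; last by rewrite lee_fin.
by rewrite -EFinD lee_fin; lra.
Qed.

(** The image of the part of [T] in a covering interval has diameter at most
    the length of that interval. *)
Lemma lebesgue_outer_lipschitz f T :
  (forall s t, T s -> T t -> `|f s - f t| <= `|s - t|) ->
  (mu (f @` T) <= mu T)%E.
Proof.
move=> fl; rewrite [leRHS]/(lebesgue_measure T).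
apply: le_ereal_inf_tmp => _ [A [mA TA] <-].
apply: (@le_trans _ _ (mu (\bigcup_k (f @` (T `&` A k))))).
  apply: le_lebesgue_outer => _ [t Tt <-].
  by have [k _ Akt] := TA _ Tt; exists k => //; exists t.
apply: le_trans (outer_measure_sigma_subadditive outer _) _.
apply: lee_nneseries => [k _ _|]; first exact: lebesgue_outer_ge0.
move=> k _; have /ocitvP[Ak0|[[a b] /= ab Ak]] := mA k.
  by rewrite Ak0 setI0 image_set0 outer_measure0 measure0.
rewrite Ak wlength_itv_bnd ?(ltW ab)//.
apply: (@lebesgue_outer_diam (f @` (T `&` `]a, b])) (b - a)).
  by rewrite subr_ge0 ltW.
move=> _ _ [s [Ts /=]] + <- [t [Tt /=]] + <-.
rewrite !in_itv/= => /andP[as_ sb] /andP[at_ tb].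
apply: le_trans (ler_norm _) _; apply: le_trans (fl _ _ Ts Tt) _.
by rewrite ler_norml; apply/andP; split; lra.
Qed.

(** Lower bound for the size of [F] once the rest of the interval is covered by
    few short intervals; this is how the number of cubes enters the estimates. *)
Lemma lebesgue_outer_cover (a b d : R) F (s : seq R) : 0 <= d -> a <= b ->
  (forall v, a <= v <= b -> F v \/ exists2 u, u \in s & `|v - u| <= d) ->
  ((b - a)%:E <= mu F + ((size s)%:R * (2 * d))%:E)%E.
Proof.
move=> d0 ab cov.
pose U (r : seq R) := [set v : R | exists2 u, u \in r & `|v - u| <= d].
have /le_trans : ((b - a)%:E <= mu (F `|` U s))%E.
  apply: (@le_trans _ _ (mu `[a, b])).
    rewrite lebesgue_measure_itv/= lte_fin; case: ltP => //.
    by rewrite lee_fin; lra.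
  by apply: le_lebesgue_outer => v /=; rewrite in_itv/= => /cov[]; [left|right].
apply; apply: le_trans (lebesgue_outerU _ _) _.
apply: leeD => //; elim: s {cov} => [|u s ih].
  rewrite mul0r (_ : U [::] = set0) ?measure0//.
  by apply/seteqP; split => // v [].
pose B := [set v : R | `|v - u| <= d].
apply: (@le_trans _ _ (mu (B `|` U s))).
  apply: le_lebesgue_outer => v /= [w]; rewrite inE => /predU1P[->|ws] h; first by left.
  by right; exists w.
apply: le_trans (lebesgue_outerU _ _) _.
rewrite /= -natr1 mulrDl mul1r addrC EFinD; apply: leeD => //.
apply: lebesgue_outer_diam => [|x y /=]; first by rewrite mulr_ge0.
rewrite /B/= !ler_norml => /andP[? ?] /andP[? ?]; lra.
Qed.

End lebesgue_outer_measure.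

Import HBNNSimple.

(** Markov's inequality without measurability of [h]: the integral of a
    nonnegative function is the supremum over simple functions below it, one of which
    is [w] times the indicator of [T]. *)
Lemma integral_ge_level d (X : measurableType d) (R : realType)
    (m : {measure set X -> \bar R}) (D T : set X) (h : X -> \bar R) (w : R) :
  measurable T -> T `<=` D -> 0 <= w ->
  (forall x, D x -> (0 <= h x)%E) -> (forall x, T x -> (w%:E <= h x)%E) ->
  (w%:E * m T <= \int[m]_(x in D) h x)%E.
Proof.
move=> mT TD w0 h0 hw; rewrite ge0_integralE//; apply: le_ereal_sup_tmp.
exists (sintegral m (scale_nnsfun (indic_nnsfun R mT) w0)); last first.
  by rewrite sintegralrM sintegral_indic.
exists (scale_nnsfun (indic_nnsfun R mT) w0) => // x /=.
rewrite measurable_realfun.mindicE.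
have [xT|xT] := boolP (x \in T).
  rewrite /= mulr1 patchE; have xT' := set_mem xT.
  by rewrite mem_set ?hw//; exact: TD.
rewrite /= mulr0 patchE; case: ifPn => // xD; apply: h0; exact: set_mem.
Qed.

(** * The weighted length near the boundary *)

Section distance_to_a_set.
Context {R : realType}.
Implicit Types (A : set (R * R)) (z w : R * R).

Lemma dist_set_le A z w : A w -> dist_set z A <= enorm (z - w).
Proof.
move=> Aw; apply: ge_inf; last by exists w.
by exists 0 => _ [v _ <-]; exact: enorm_ge0.
Qed.

Lemma dist_set_lt A z (d : R) : A !=set0 -> dist_set z A < d ->
  exists2 w, A w & enorm (z - w) < d.
Proof.
move=> [w Aw]; rewrite /dist_set => /inf_lt[|_ [v Av <-] vd]; last by exists v.
by exists (enorm (z - w)); exists w.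
Qed.

Lemma dist_set_lipschitz A z w : A !=set0 ->
  dist_set z A <= dist_set w A + enorm (z - w).
Proof.
move=> [v Av]; rewrite -lerBlDr; apply: lb_le_inf; first by exists (enorm (w - v)), v.
move=> _ [u Au <-]; rewrite lerBlDr.
by have := dist_set_le z Au; have := ler_enorm_dist z w u; lra.
Qed.

Lemma dist_set_gt0 A z : closed A -> A !=set0 -> ~ A z -> 0 < dist_set z A.
Proof.
move=> cA A0 Az; have : nbhs z (~` A) by apply: open_nbhs_nbhs; split => //; exact: closed_openC.
move=> /nbhs_ballP[e /= e0 be]; apply: (@lt_le_trans _ _ e) => //.
rewrite leNgt; apply/negP => /(dist_set_lt A0)[w Aw zw].
apply: (be w) => //; rewrite -ball_normE /=; exact: le_lt_trans (le_normr_enorm _) zw.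
Qed.

Lemma closed_boundary A : closed (boundary A).
Proof.
rewrite /boundary setDE; apply: closedI; first exact: closed_closure.
by apply: open_closedC; exact: open_interior.
Qed.

End distance_to_a_set.

Section weighted_length.
Context {R : realType}.
Local Notation mu := (@lebesgue_measure R).
Variables (Omega : set (R * R)) (p : R) (c : R -> R * R).
Hypothesis p1 : 1 < p.
Hypothesis E0 : boundary Omega !=set0.
Hypothesis cc : {within `[0, 1], continuous c}.
Hypothesis lc : (curve_length c 0 1 < +oo)%E.

Let L := fine (curve_length c 0 1).
Let delta s := dist_set (arc_length_param c s) (boundary Omega).

Definition near_params (d : R) : set R :=
  [set s | 0 <= s <= L /\ delta s <= d].

Lemma dist_weight_ge0 z : (0 <= dist_weight Omega p z)%E.
Proof. by rewrite /dist_weight; case: ifP => // _; rewrite lee_fin powR_ge0. Qed.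

(** The exponent [1 - p] is negative, so the weight is large near the boundary.
    Off the boundary the distance is positive, as the boundary is closed. *)
Lemma dist_weight_ge z (d : R) : dist_set z (boundary Omega) <= d ->
  ((d `^ (1 - p))%:E <= dist_weight Omega p z)%E.
Proof.
rewrite /dist_weight; case: asboolP => [_ _|Ez zd]; first by rewrite leey.
have z0 := dist_set_gt0 (@closed_boundary _ Omega) E0 Ez.
have d0 := lt_le_trans z0 zd.
rewrite lee_fin -opprB !powRN lef_pV2 ?posrE ?powR_gt0//.
by apply: ge0_ler_powR => //; rewrite ?nnegrE ?subr_ge0; exact: ltW.
Qed.

(** The distance to the boundary is a Lipschitz function of the arc length between 0
    and the total length; clamping the parameter makes it continuous on the line. *)
Lemma measurable_near_params d : measurable (near_params d : set (measurableTypeR R)).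
Proof.
have L0 : 0 <= L by rewrite fine_ge0// curve_length_ge0.
pose k (s : R) := Num.max 0 (Num.min s L).
have k01 s : 0 <= k s <= L by rewrite /k le_max lexx/= ge_max L0 ge_min lexx orbT.
have klip s s' : `|k s - k s'| <= `|s - s'|.
  rewrite /k /Num.max /Num.min.
  by repeat case: ifPn; rewrite -?leNgt => *; rewrite ler_norml;
     have := ler_norm (s - s'); have := ler_norm (s' - s); rewrite (distrC s') => *;
     apply/andP; split; lra.
have dlip s s' : `|delta (k s) - delta (k s')| <= `|s - s'|.
  apply: le_trans (klip s s'); have /andP[? ?] := k01 s; have /andP[? ?] := k01 s'.
  apply: le_trans (arc_length_param_lipschitz cc lc _ _ _ _) => //.
  rewrite /delta; set z := arc_length_param c (k s); set w := arc_length_param c (k s').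
  have := dist_set_lipschitz z w E0; have := dist_set_lipschitz w z E0.
  by rewrite (enorm_distC w) => *; rewrite ler_norml; apply/andP; split; lra.
have dc : continuous (delta \o k : R -> R).
  move=> s; apply/cvgrPdist_lt => e e0; near=> u.
  apply: le_lt_trans (dlip _ _) _; near: u.
  by apply: cvgr_dist_lt.
have -> : near_params d = `[0, L]%classic `&` (delta \o k) @^-1` [set y | y <= d].
  have kE s : 0 <= s <= L -> k s = s.
    by move=> /andP[s0 sL]; rewrite /k (min_idPl sL) (max_idPr s0).
  by apply/seteqP; split => s /=; rewrite in_itv/= => -[sL]; rewrite kE.
apply: measurableI; first exact: measurable_itv.
apply: measurable_realfun.closed_measurable; apply: closed_comp => //; exact: closed_le.
Unshelve. all: by end_near. Qed.

Lemma line_integral_ge d :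
  ((d `^ (1 - p))%:E * mu (near_params d) <= line_integral c (dist_weight Omega p))%E.
Proof.
apply: integral_ge_level.
- exact: measurable_near_params.
- by move=> s [sL _] /=; rewrite in_itv/=.
- exact: powR_ge0.
- by move=> s _; exact: dist_weight_ge0.
- by move=> s [_ sd]; exact: dist_weight_ge.
Qed.

End weighted_length.

(** * Loops separate: crossing numbers modulo 2 *)

Section connected_chains.
Context {R : realType}.
Implicit Types (A : set (R * R)) (u v w : R * R).

(** The points related to [u] form a subset that is open and closed in [A].
    Both directions of [P] are required locally, one for each half of the argument. *)
Lemma connected_local_relation A (P : R * R -> R * R -> Prop) :
  connected A ->
  (forall u v w, P u v -> P v w -> P u w) ->
  (forall v, A v -> exists2 r : R, 0 < r &
     forall w, A w -> `|v - w| < r -> P v w /\ P w v) ->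
  forall u w, A u -> A w -> P u w.
Proof.
move=> cA tr loc u w Au Aw.
pose nb (B : set (R * R)) : set (R * R) :=
  [set v | exists b r, [/\ B b, 0 < r, `|b - v| < r &
     forall w, A w -> `|b - w| < r -> P b w /\ P w b]].
have nb_open B : open (nb B).
  rewrite openE => v [b [r [Bb r0 bv br]]].
  apply/nbhs_ballP; exists (r - `|b - v|) => /=; first by rewrite subr_gt0.
  move=> v'; rewrite -ball_normE /= => vv'; exists b, r; split => //.
  by have := ler_normD (b - v) (v - v'); rewrite subrKA; lra.
have nb_sub B : B `<=` A -> B `<=` nb B.
  move=> BA b Bb; have [r r0 br] := loc _ (BA _ Bb).
  by exists b, r; split => //; rewrite subrr normr0.
pose B := [set v | A v /\ P u v].
suff /seteqP[_ /(_ w Aw)[]] : B = A by [].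
apply: cA.
- exists u; split => //; have [r r0 /(_ u Au)] := loc _ Au.
  by rewrite subrr normr0 => /(_ r0)[].
- exists (nb B) => //; apply/seteqP; split => v.
    by move=> Bv; split; [case: Bv|apply: nb_sub => // ? []].
  move=> [Av [b [r [[Ab Pub] r0 bv br]]]]; split => //.
  by apply: tr Pub _; case: (br v Av bv).
- exists (~` nb (A `\` B)); first exact: open_closedC.
  apply/seteqP; split => v.
    move=> [Av Puv]; split => // -[b [r [[Ab nBb] r0 bv br]]].
    by apply: nBb; split => //; apply: tr Puv _; case: (br v Av bv).
  by move=> [Av nv]; apply: contrapT => nBv; apply: nv; apply: nb_sub => // ? [].
Qed.

Definition step (d : R) : rel (R * R) := fun v w => `|v - w| <= d.

Definition chained A (d : R) u w :=
  exists s, [/\ path (step d) u s, last u s = w & forall v, v \in u :: s -> A v].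

Lemma chained_trans A d u v w : chained A d u v -> chained A d v w -> chained A d u w.
Proof.
move=> [s [ps ls As]] [t [pt lt At]]; exists (s ++ t); split.
- by rewrite cat_path ps ls.
- by rewrite last_cat ls.
- move=> z; rewrite inE mem_cat orbA => /orP[zs|zt]; first by apply: As; rewrite inE.
  by apply: At; rewrite inE zt orbT.
Qed.

Lemma chained_sub A B d u w : A `<=` B -> chained A d u w -> chained B d u w.
Proof. by move=> AB [s [ps ls As]]; exists s; split => // v /As /AB. Qed.

Lemma chained_mem A d u w : chained A d u w -> A u /\ A w.
Proof.
move=> [s [ps ls As]]; split; apply: As; first exact: mem_head.
by rewrite -ls mem_last.
Qed.

Lemma connected_chained A (d : R) : 0 < d -> connected A ->
  forall u w, A u -> A w -> chained A d u w.
Proof.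
move=> d0 cA; apply: (connected_local_relation (P := chained A d)) => //.
  by move=> u v w; exact: chained_trans.
have one v w : A v -> A w -> `|v - w| < d -> chained A d v w.
  move=> Av Aw vw; exists [:: w]; split => //=; first by rewrite andbT /step ltW.
  by move=> z; rewrite !inE => /orP[] /eqP ->.
move=> v Av; exists d => // w Aw vw; split; first exact: one.
by apply: one => //; rewrite distrC.
Qed.

(** Curves are used only through the fine chains of points on them, which is
    all that the crossing number below can see. *)
Lemma curve_chained (c : R -> R * R) A (d : R) : 0 < d ->
  {within `[0, 1], continuous c} -> c @` `[0, 1] `<=` A -> chained A d (c 0) (c 1).
Proof.
move=> d0 cc cA; apply: (chained_sub cA); apply: connected_chained => //.
- apply: connected_continuous_connected => //; exact: segment_connected.
- by exists 0 => //=; rewrite in_itv/= lexx ler01.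
- by exists 1 => //=; rewrite in_itv/= lexx ler01.
Qed.

End connected_chains.

Section crossing_parity.
Context {R : realType}.
Implicit Types (w y : R * R) (s : seq (R * R)) (d : R).

(** Whether the step from [y] to [y'], first horizontal at the height of [y] and
    then vertical, crosses the open vertical ray above [w]. *)
Definition crosses_above w y y' : bool :=
  ((y.1 <= w.1) (+) (y'.1 <= w.1)) && (w.2 < y.2).

(** The winding number of a closed chain around [w], modulo 2. *)
Fixpoint crossing_parity w y s : bool :=
  if s is y' :: s' then crosses_above w y y' (+) crossing_parity w y' s' else false.

Lemma crossing_parity_cat w y s t :
  crossing_parity w y (s ++ t) =
  crossing_parity w y s (+) crossing_parity w (last y s) t.
Proof. by elim: s y => //= y' s ih y; rewrite ih addbA. Qed.

Lemma crossing_parity_right w y s :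
  (forall v, v \in y :: s -> w.1 < v.1) -> crossing_parity w y s = false.
Proof.
elim: s y => //= y' s ih y h; rewrite ih; last by move=> v vs; apply: h; rewrite inE vs orbT.
have h1 := h y (mem_head _ _); have h2 : w.1 < y'.1 by apply: h; rewrite !inE eqxx orbT.
by rewrite /crosses_above !leNgt h1 h2.
Qed.

Lemma crossing_parity_left w y s :
  (forall v, v \in y :: s -> v.1 <= w.1) -> crossing_parity w y s = false.
Proof.
elim: s y => //= y' s ih y h; rewrite ih; last by move=> v vs; apply: h; rewrite inE vs orbT.
have h1 := h y (mem_head _ _); have h2 : y'.1 <= w.1 by apply: h; rewrite !inE eqxx orbT.
by rewrite /crosses_above h1 h2.
Qed.

Lemma crossing_parity_below w y s :
  (forall v, v \in y :: s -> v.2 <= w.2) -> crossing_parity w y s = false.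
Proof.
elim: s y => //= y' s ih y h; rewrite ih; last by move=> v vs; apply: h; rewrite inE vs orbT.
have h1 := h y (mem_head _ _).
by rewrite /crosses_above [_ < _]ltNge h1 andbF.
Qed.

Lemma crossing_parity_above w y s :
  (forall v, v \in y :: s -> w.2 < v.2) ->
  crossing_parity w y s = (y.1 <= w.1) (+) ((last y s).1 <= w.1).
Proof.
elim: s y => [|y' s ih] y h /=; first by rewrite addbb.
rewrite ih; last by move=> v vs; apply: h; rewrite inE vs orbT.
have h1 := h y (mem_head _ _).
by rewrite /crosses_above h1 andbT; do 3 case: (_ <= _).
Qed.

(** As long as [w] stays away from the chain, a crossing can only be lost or gained
    because the chain enters or leaves the vertical strip swept by the ray; [f] tells
    whether a vertex lies in that strip. *)
Lemma crosses_above_move w w' y y' (r d : R) :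
  `|w - w'| <= r -> `|y - y'| <= d -> r + d < `|y - w| -> r + d < `|y' - w| ->
  let f v := ((v.1 <= w.1) (+) (v.1 <= w'.1)) && (w'.2 < v.2) in
  crosses_above w y y' = crosses_above w' y y' (+) (f y (+) f y').
Proof.
move=> /[dup]/(le_trans (normr_ge0 _)) r0 + /[dup]/(le_trans (normr_ge0 _)) d0.
rewrite !normr_pair_le /= => /andP[]; rewrite !ler_norml => /andP[a1 a2] /andP[a3 a4].
move=> /andP[/andP[b1 b2] /andP[b3 b4]] far far' /=.
have {}far : ~ (w.1 - (r + d) <= y.1 <= w.1 + (r + d) /\
                w.2 - (r + d) <= y.2 <= w.2 + (r + d)).
  move=> [/andP[? ?] /andP[? ?]]; move: far; rewrite ltNge => /negP; apply.
  by rewrite normr_pair_le /= !ler_norml; apply/andP; split; apply/andP; split; lra.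
have {}far' : ~ (w.1 - (r + d) <= y'.1 <= w.1 + (r + d) /\
                 w.2 - (r + d) <= y'.2 <= w.2 + (r + d)).
  move=> [/andP[? ?] /andP[? ?]]; move: far'; rewrite ltNge => /negP; apply.
  by rewrite normr_pair_le /= !ler_norml; apply/andP; split; apply/andP; split; lra.
(* Moving the ray up or down matters only near its endpoint, where the chain
   is absent. *)
have eA : ((y.1 <= w.1) (+) (y'.1 <= w.1)) && (w.2 < y.2) =
          ((y.1 <= w.1) (+) (y'.1 <= w.1)) && (w'.2 < y.2).
  case: (boolP (_ (+) _)) => // h; have hw : w.1 - (r + d) <= y.1 <= w.1 + (r + d).
    move: h; have [?|?] := leP y.1 w.1; have [?|?] := leP y'.1 w.1 => // _;
      by apply/andP; split; lra.
  by have [?|?] := ltP w.2 y.2; have [?|?] := ltP w'.2 y.2 => //; exfalso;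
     apply: far; split => //; apply/andP; split; lra.
have eB : ((y'.1 <= w.1) (+) (y'.1 <= w'.1)) && (w'.2 < y'.2) =
          ((y'.1 <= w.1) (+) (y'.1 <= w'.1)) && (w'.2 < y.2).
  case: (boolP (_ (+) _)) => // h; have hw : w.1 - (r + d) <= y'.1 <= w.1 + (r + d).
    move: h; have [?|?] := leP y'.1 w.1; have [?|?] := leP y'.1 w'.1 => // _;
      by apply/andP; split; lra.
  by have [?|?] := ltP w'.2 y'.2; have [?|?] := ltP w'.2 y.2 => //; exfalso;
     apply: far'; split => //; apply/andP; split; lra.
rewrite /crosses_above eA eB; case: (w'.2 < y.2); rewrite ?andbF ?andbT//.
by do 4 case: (_ <= _).
Qed.

(** A closed chain enters the strip swept by the ray as often as it leaves it, so
    the corrections of [crosses_above_move] telescope to zero. *)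
Lemma crossing_parity_move w w' y s (r d : R) :
  `|w - w'| <= r -> path (step d) y s -> last y s = y ->
  (forall v, v \in y :: s -> r + d < `|v - w|) ->
  crossing_parity w y s = crossing_parity w' y s.
Proof.
move=> ww'; pose f (v : R * R) := ((v.1 <= w.1) (+) (v.1 <= w'.1)) && (w'.2 < v.2).
move=> ps ls far.
suff -> : crossing_parity w y s =
    crossing_parity w' y s (+) (f y (+) f (last y s)).
  by rewrite ls addbb addbF.
elim: s y ps far {ls} => [|y' s ih] y /=; first by rewrite addbb.
move=> /andP[yy' ps] far.
rewrite (ih y' ps); last by move=> v vs; apply: far; rewrite inE vs orbT.
rewrite (crosses_above_move ww' yy').
- rewrite -/(f y) -/(f y'); case: (crosses_above _ _ _).
    by case: (crossing_parity _ _ _); case: (f y); case: (f y'); case: (f _).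
  by case: (crossing_parity _ _ _); case: (f y); case: (f y'); case: (f _).
- exact/far/mem_head.
- by apply: far; rewrite !inE eqxx orbT.
Qed.

(** The mesh of the chain has to be small compared with the distance from the
    chain to the path in [Omega] that [w] follows, whence the bound [d], found together
    with the equality of parities by local propagation. *)
Lemma connected_crossing_parity (Omega : set (R * R)) u w :
  open Omega -> connected Omega -> Omega u -> Omega w ->
  exists2 d, 0 < d & forall y s, path (step d) y s -> last y s = y ->
    (forall v, v \in y :: s -> ~ Omega v) ->
    crossing_parity u y s = crossing_parity w y s.
Proof.
move=> oO cO; move: u w.
apply: (connected_local_relation (P := fun u w => exists2 d, 0 < d &
  forall y s, path (step d) y s -> last y s = y ->
    (forall v, v \in y :: s -> ~ Omega v) ->
    crossing_parity u y s = crossing_parity w y s)) => //.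
  move=> u v w [d d0 uv] [e e0 vw]; exists (Num.min d e); first by rewrite lt_min d0.
  move=> y s ps ls Os; rewrite uv ?vw//; apply: sub_path ps => a b; rewrite /step le_min.
    by move=> /andP[].
  by move=> /andP[].
move=> v Ov; have : nbhs v Omega by apply: open_nbhs_nbhs.
move=> /nbhs_ballP[e /= e0 be].
have e3 : 0 < e / 3 by rewrite divr_gt0.
exists (e / 3) => // w Ow vw.
suff P : exists2 d, 0 < d & forall y s, path (step d) y s -> last y s = y ->
    (forall v, v \in y :: s -> ~ Omega v) ->
    crossing_parity v y s = crossing_parity w y s.
  by split=> //; case: P => d d0 P; exists d => // y s ps ls Os; rewrite P.
exists (e / 3) => // y s ps ls Os.
apply: (crossing_parity_move (ltW vw) ps ls) => z zs.
rewrite ltNge; apply/negP => zv; apply: (Os z zs); apply: be.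
by rewrite -ball_normE /= distrC; apply: le_lt_trans zv _; lra.
Qed.

(** A ray from a point beside or above the box is never crossed; a ray from below
    is crossed an even number of times by a closed chain that lies entirely above its
    origin. *)
Lemma crossing_parity_outside w x y s (r : R) :
  last y s = y -> r <= `|w - x| -> (forall v, v \in y :: s -> `|v - x| < r) ->
  crossing_parity w y s = false.
Proof.
move=> ls wx ins.
have {}ins v : v \in y :: s ->
    [/\ x.1 - r < v.1, v.1 < x.1 + r, x.2 - r < v.2 & v.2 < x.2 + r].
  move=> /ins; rewrite normr_pair_lt !ltr_norml /= => /andP[/andP[? ?] /andP[? ?]].
  by split; lra.
have [h|h1] := leP w.1 (x.1 - r).
  by apply: crossing_parity_right => v /ins[? ? ? ?]; lra.
have [h|h2] := leP (x.1 + r) w.1.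
  by apply: crossing_parity_left => v /ins[? ? ? ?]; lra.
have [h|h3] := leP (x.2 + r) w.2.
  by apply: crossing_parity_below => v /ins[? ? ? ?]; lra.
rewrite crossing_parity_above ?ls ?addbb// => v /ins[? ? ? ?].
suff : w.2 <= x.2 - r by lra.
rewrite leNgt; apply/negP => h4; move: wx; rewrite leNgt => /negP; apply.
by rewrite normr_pair_lt !ltr_norml /=; apply/andP; split; apply/andP; split; lra.
Qed.

(** A substitute for the Jordan curve theorem: a loop in the complement of [Omega]
    made of a path above [w0], one on its left, one below and one on its right has odd
    crossing number around [w0], but even crossing number around the point [w1] outside. *)
Lemma loop_separates (Omega : set (R * R)) x w0 w1 tr tl bl br (r : R) :
  open Omega -> connected Omega -> Omega w0 -> Omega w1 -> r <= `|w1 - x| ->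
  (forall d, 0 < d -> [/\
    chained (~` Omega `&` [set v | `|v - x| < r] `&` [set v | w0.2 < v.2]) d tr tl,
    chained (~` Omega `&` [set v | `|v - x| < r] `&` [set v | v.1 < w0.1]) d tl bl,
    chained (~` Omega `&` [set v | `|v - x| < r] `&` [set v | v.2 < w0.2]) d bl br &
    chained (~` Omega `&` [set v | `|v - x| < r] `&` [set v | w0.1 < v.1]) d br tr]) ->
  False.
Proof.
move=> oO cO O0 O1 w1x sides.
have [d d0 par] := connected_crossing_parity oO cO O0 O1.
have [ctop cleft cbot cright] := sides d d0.
have [[_ /= tlw] _] := chained_mem cleft.
have [_ [_ /= trw]] := chained_mem cright.
move: ctop cleft => [s1 [p1 l1 i1]] [s2 [p2 l2 i2]].
move: cbot cright => [s3 [p3 l3 i3]] [s4 [p4 l4 i4]].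
(* Around [w0], only the top path crosses the ray, an odd number of times. *)
pose s := ((s1 ++ s2) ++ s3) ++ s4.
have inK v : v \in tr :: s -> (~` Omega `&` [set v | `|v - x| < r]) v.
  rewrite inE !mem_cat => /orP[/eqP ->|/orP[/orP[/orP[h|h]|h]|h]].
  - by case: (i1 tr (mem_head _ _)).
  - by have [] := i1 v; rewrite ?inE ?h ?orbT.
  - by have [] := i2 v; rewrite ?inE ?h ?orbT.
  - by have [] := i3 v; rewrite ?inE ?h ?orbT.
  - by have [] := i4 v; rewrite ?inE ?h ?orbT.
have ls : last tr s = tr by rewrite !last_cat l1 l2 l3.
have ps : path (step d) tr s by rewrite !cat_path !last_cat l1 l2 l3 p1 p2 p3.
have := par tr s ps ls (fun v vs => proj1 (inK v vs)).
rewrite (crossing_parity_outside ls w1x (fun v vs => proj2 (inK v vs))).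
rewrite !crossing_parity_cat !last_cat l1 l2 l3.
rewrite (crossing_parity_left (s := s2)); last by move=> v /i2[_ /= /ltW].
rewrite (crossing_parity_below (s := s3)); last by move=> v /i3[_ /= /ltW].
rewrite (crossing_parity_right (s := s4)); last by move=> v /i4[_ /=].
rewrite crossing_parity_above; last by move=> v /i1[_ /=].
by rewrite l1 leNgt trw (ltW tlw).
Qed.

End crossing_parity.

(** * Whitney cells and their layers of cubes *)

Section dyadic_cells.
Context {R : realType}.
Implicit Types (x y z : R * R) (t u : R) (m M k : nat).

Lemma exp2V_gt0 m : 0 < 2 ^- m :> R.
Proof. by rewrite invr_gt0 exprn_gt0. Qed.

Lemma exp2V_split m M : (m <= M)%N -> 2 ^- m = 2 ^+ (M - m) * 2 ^- M :> R.
Proof.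
move=> mM; rewrite -[in RHS](subnK mM) addnC -[(m + (M - m) - m)%N]/(_) exprD invfM.
by rewrite addKn mulrC mulfVK// expf_neq0.
Qed.

Lemma exp2VS m : 2 ^- m = 2 * 2 ^- m.+1 :> R.
Proof. by rewrite (exp2V_split (leqnSn m)) subSnn expr1. Qed.

(** Points are compared through the lower left corner of the half-open dyadic
    cell that contains them, so that cells themselves need not be named. *)
Definition grid_floor m t : R := (Num.floor (2 ^+ m * t))%:~R * 2 ^- m.

Lemma grid_floor_itv m t : grid_floor m t <= t < grid_floor m t + 2 ^- m.
Proof.
have e0 : 2 ^+ m != 0 :> R by rewrite expf_neq0.
have /andP[f1 f2] := floor_itv (2 ^+ m * t); apply/andP; split.
  by rewrite /grid_floor ler_pdivrMr ?exprn_gt0// [leRHS]mulrC.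
rewrite /grid_floor -[X in _ + X]mul1r -mulrDl ltr_pdivlMr ?exprn_gt0// [ltLHS]mulrC.
by rewrite intrD in f2.
Qed.

Lemma grid_floor_eq m t u :
  grid_floor m t <= u < grid_floor m t + 2 ^- m -> grid_floor m u = grid_floor m t.
Proof.
move=> /andP[u1 u2]; rewrite /grid_floor; congr (_%:~R * _).
apply: floor_def; apply/andP; split.
  by rewrite [leRHS]mulrC -ler_pdivrMr ?exprn_gt0.
rewrite intrD [ltLHS]mulrC -ltr_pdivlMr ?exprn_gt0//.
by rewrite mulrDl mul1r.
Qed.

Lemma grid_floor_coarser m M t u : (m <= M)%N ->
  grid_floor M t = grid_floor M u -> grid_floor m t = grid_floor m u.
Proof.
move=> mM; have e0 n : 2 ^+ n != 0 :> R by rewrite expf_neq0.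
move=> /(mulIf (invr_neq0 (e0 M))) /intr_inj fE; congr (_%:~R * _).
have key (v : R) (n : int) : (n <= Num.floor (2 ^+ m * v)) =
    (n * 2 ^+ (M - m) <= Num.floor (2 ^+ M * v)).
  rewrite !floor_ge_int -(subnKC mM) exprD addKn rmorphM /= rmorphXn /=.
  by rewrite [in RHS]mulrAC ler_pM2r// exprn_gt0.
by apply/eqP; rewrite eq_le key -fE -key lexx key fE -key lexx.
Qed.

Definition same_cell m y z : Prop :=
  grid_floor m y.1 = grid_floor m z.1 /\ grid_floor m y.2 = grid_floor m z.2.

Lemma same_cell_sym m y z : same_cell m y z -> same_cell m z y.
Proof. by case. Qed.

Lemma same_cell_trans m x y z : same_cell m x y -> same_cell m y z -> same_cell m x z.
Proof. by move=> [h1 h2] [h3 h4]; split; [rewrite h1|rewrite h2]. Qed.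

Lemma same_cell_coarser m M y z : (m <= M)%N -> same_cell M y z -> same_cell m y z.
Proof. by move=> mM [h1 h2]; split; apply: grid_floor_coarser mM _. Qed.

Lemma same_cell_dist m y z : same_cell m y z -> `|y - z| <= 2 ^- m.
Proof.
move=> [h1 h2]; rewrite normr_pair_le /= !ler_norml.
have /andP[? ?] := grid_floor_itv m y.1; have /andP[? ?] := grid_floor_itv m z.1.
have /andP[? ?] := grid_floor_itv m y.2; have /andP[? ?] := grid_floor_itv m z.2.
by apply/andP; split; apply/andP; split; lra.
Qed.

End dyadic_cells.

Section whitney_cubes.
Context {R : realType}.
Variable E : set (R * R).
Implicit Types (x y z : R * R) (m M k a b : nat) (Q : @cube R).

(** The distance is at least 20 times the side: then such a cell that meets the annulus
    [11 / 20 r <= |z - x| <= 61 / 100 r] around a point [x] of [E] has side at most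
    [61 / 2000 r], and lies in the annulus [r / 2 <= |z - x| < r]. *)
Definition far_cell m y : Prop :=
  forall z, same_cell m z y -> forall e, E e -> 20 * 2 ^- m <= `|z - e|.

(** The Whitney cells of [E] are the maximal dyadic cells that are far from [E],
    that is, the first far ones met while refining the grid. *)
Definition whitney_cell m y : Prop :=
  far_cell m y /\ forall n, (n < m)%N -> ~ far_cell n y.

Lemma far_cell_same m y z : same_cell m y z -> far_cell m y -> far_cell m z.
Proof. by move=> yz fy w wz; apply: fy; apply: same_cell_trans wz (same_cell_sym yz). Qed.

Lemma whitney_cell_same m y z : same_cell m y z -> whitney_cell m y -> whitney_cell m z.
Proof.
move=> yz [fy ny]; split; first exact: far_cell_same fy.
move=> n nm fz; apply: (ny n nm); apply: far_cell_same fz.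
exact/same_cell_sym/(same_cell_coarser (ltnW nm)).
Qed.

Lemma whitney_cell_uniq m n y : whitney_cell m y -> whitney_cell n y -> m = n.
Proof.
move=> [fm nm] [fn nn]; case: (ltngtP m n) => // h.
  by case: (nn m h).
by case: (nm n h).
Qed.

Lemma whitney_cell_exists m y : far_cell m y ->
  exists2 n, (n <= m)%N & whitney_cell n y.
Proof.
move=> fm; have ex : exists n, `[< far_cell n y >] by exists m; apply/asboolP.
case: (ex_minnP ex) => n /asboolP fn min; exists n; first by apply: min; apply/asboolP.
by split => // l ln fl; have := min l (asboolT fl); rewrite leqNgt ln.
Qed.

Definition offset_corner m M y a b : R * R :=
  (grid_floor m y.1 + a%:R * 2 ^- M, grid_floor m y.2 + b%:R * 2 ^- M).

(** A Whitney cell of side [2 ^- m] has to supply, for every [M > m], about as many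
    disjoint cubes of side [2 ^- M] as fit along one of its sides, and the cubes for
    distinct [M] have to be disjoint too. The cubes with [min (a, b) = 1] fill the L-shaped
    layer of the cell at distance between [2 ^- M] and [2 * 2 ^- M] from its left and lower
    sides; these layers are disjoint, and each projects onto both sides of the cell except
    for one slot at the end. *)
Definition whitney_subcube Q : Prop :=
  exists m M y a b, [/\ (m < M)%N, whitney_cell m y,
    [/\ (a < 2 ^ (M - m))%N, (b < 2 ^ (M - m))%N & minn a b = 1%N],
    side Q = 2 ^- M & corner Q = offset_corner m M y a b].

Lemma offset_in_cell m M a (t o : R) : (m <= M)%N -> (a < 2 ^ (M - m))%N ->
  o + a%:R * 2 ^- M < t < o + a%:R * 2 ^- M + 2 ^- M -> o <= t < o + 2 ^- m.
Proof.
move=> mM am /andP[t1 t2]; have s0 := exp2V_gt0 M : 0 < 2 ^- M :> R.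
have a0 : 0 <= a%:R * 2 ^- M :> R by rewrite mulr_ge0// ltW.
have : (a%:R + 1) * 2 ^- M <= 2 ^- m :> R.
  rewrite (exp2V_split mM) ler_pM2r// natr1 -natrX ler_nat.
  exact: am.
by rewrite mulrDl mul1r => h; apply/andP; split; lra.
Qed.

Lemma whitney_subcube_same_cell m M y a b Q z :
  (m < M)%N -> (a < 2 ^ (M - m))%N -> (b < 2 ^ (M - m))%N ->
  side Q = 2 ^- M -> corner Q = offset_corner m M y a b ->
  cube_set Q z -> same_cell m z y.
Proof.
move=> mM am bm sQ cQ; rewrite /cube_set /= sQ cQ /= => -[z1 z2].
by split; apply: grid_floor_eq;
  [exact: offset_in_cell (ltnW mM) am z1|exact: offset_in_cell (ltnW mM) bm z2].
Qed.

Lemma nat_slot_uniq (s t : R) a b : 0 < s ->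
  a%:R * s < t < a%:R * s + s -> b%:R * s < t < b%:R * s + s -> a = b.
Proof.
move=> s0 /andP[a1 a2] /andP[b1 b2].
have lt (i j : nat) : i%:R * s < j%:R * s + s -> (i <= j)%N.
  by rewrite -[X in _ + X]mul1r -mulrDl natr1 ltr_pM2r// ltr_nat ltnS.
by apply/eqP; rewrite eqn_leq !lt//; lra.
Qed.

(** Reading off [M] from a point of the cube, through its distance to the left and
    lower sides of the cell. *)
Lemma whitney_subcube_layer m M y a b Q z :
  minn a b = 1%N -> side Q = 2 ^- M -> corner Q = offset_corner m M y a b ->
  cube_set Q z ->
  let l := Num.min (z.1 - grid_floor m y.1) (z.2 - grid_floor m y.2) in
  2 ^- M < l < 2 * 2 ^- M.
Proof.
move=> ab sQ cQ; rewrite /cube_set /= sQ cQ /= => -[/andP[z1 z2] /andP[z3 z4]].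
have s0 := exp2V_gt0 M : 0 < 2 ^- M :> R.
have le1 (i : nat) : (1 <= i)%N -> 2 ^- M <= i%:R * 2 ^- M :> R.
  by move=> i1; rewrite -[leLHS]mul1r ler_pM2r// ler1n.
have /andP[a1 b1] : (1 <= a)%N && (1 <= b)%N by rewrite -leq_min ab.
rewrite lt_min gt_min; apply/andP; split.
  by apply/andP; split; [have := le1 a a1|have := le1 b b1]; lra.
have [E1|E1] : a = 1%N \/ b = 1%N by move: ab; rewrite /minn; case: ifP; [left|right].
  by rewrite E1 mul1r in z2; apply/orP; left; lra.
by rewrite E1 mul1r in z4; apply/orP; right; lra.
Qed.

Lemma exp2V_layer_uniq M N (l : R) :
  2 ^- M < l < 2 * 2 ^- M -> 2 ^- N < l < 2 * 2 ^- N -> M = N.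
Proof.
move=> /andP[M1 M2] /andP[N1 N2].
have le (i j : nat) : (i < j)%N -> 2 * 2 ^- j <= 2 ^- i :> R.
  move=> ij; rewrite (exp2VS i) ler_pM2l// lef_pV2 ?posrE ?exprn_gt0//.
  by rewrite ler_weXn2l// ler1n.
by case: (ltngtP M N) => // /le h; exfalso; lra.
Qed.

Lemma trivIset_whitney_subcube : trivIset whitney_subcube (@cube_set R).
Proof.
move=> Q Q' [m [M [y [a [b [mM wy [am bm ab] sQ cQ]]]]]].
move=> [m' [M' [y' [a' [b' [mM' wy' [am' bm' ab'] sQ' cQ']]]]]] [z [zQ zQ']].
have zy := whitney_subcube_same_cell mM am bm sQ cQ zQ.
have zy' := whitney_subcube_same_cell mM' am' bm' sQ' cQ' zQ'.
have wz := whitney_cell_same (same_cell_sym zy) wy.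
have wz' := whitney_cell_same (same_cell_sym zy') wy'.
have mm := whitney_cell_uniq wz wz'; subst m'.
have [q1 q2] := same_cell_trans (same_cell_sym zy) zy'.
have l1 := whitney_subcube_layer ab sQ cQ zQ.
have l2 := whitney_subcube_layer ab' sQ' cQ' zQ'.
rewrite -q1 -q2 in l2; have eM := exp2V_layer_uniq l1 l2; subst M'.
have s0 := exp2V_gt0 M : 0 < 2 ^- M :> R.
move: (zQ) (zQ'); rewrite /cube_set /= sQ cQ sQ' cQ' /= => -[/andP[z1 z2] /andP[z3 z4]].
rewrite -q1 -q2 => -[/andP[z1' z2'] /andP[z3' z4']].
have ea : a = a'.
  by apply: (nat_slot_uniq (t := z.1 - grid_floor m y.1) s0); apply/andP; split; lra.
have eb : b = b'.
  by apply: (nat_slot_uniq (t := z.2 - grid_floor m y.2) s0); apply/andP; split; lra.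
have ec : corner Q = corner Q' by rewrite cQ cQ' /offset_corner q1 q2 ea eb.
have es : side Q = side Q' by rewrite sQ sQ'.
clear -ec es; case: Q Q' ec es => [c s p] [c' s' p'] /= ? ?; subst.
by rewrite (bool_irrelevance p p').
Qed.

Lemma whitney_subcube_avoids Q : whitney_subcube Q -> cube_set Q `<=` ~` E.
Proof.
move=> [m [M [y [a [b [mM [fy _] [am bm _] sQ cQ]]]]]] z zQ Ez.
have := fy z (whitney_subcube_same_cell mM am bm sQ cQ zQ) z Ez.
by rewrite subrr normr0 pmulr_rle0// leNgt exp2V_gt0.
Qed.

(** The constants are those announced at [far_cell]; the upper one is multiplied by
    [3 / 2] to pass to the Euclidean norm. *)
Lemma whitney_subcube_annulus m M y a b Q x k (r := 2 ^- k : R) :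
  (m < M)%N -> far_cell m y -> (a < 2 ^ (M - m))%N -> (b < 2 ^ (M - m))%N ->
  side Q = 2 ^- M -> corner Q = offset_corner m M y a b -> E x ->
  11 / 20 * r <= `|y - x| -> `|y - x| <= 61 / 100 * r ->
  cube_set Q `<=` annulus x k.
Proof.
move=> mM fy am bm sQ cQ Ex y1 y2 z zQ.
have d := same_cell_dist (whitney_subcube_same_cell mM am bm sQ cQ zQ).
have f : 20 * 2 ^- m <= `|y - x| by exact: fy.
have r0 : 0 < r by exact: exp2V_gt0.
have rS : r = 2 * 2 ^- k.+1 by rewrite /r exp2VS.
have h1 := ler_normD (z - y) (y - x); rewrite subrKA in h1.
have h2 := ler_normD (y - z) (z - x); rewrite subrKA in h2.
have h3 := enorm_le_normr (z - x); have h4 := le_normr_enorm (z - x).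
rewrite /annulus /eball /= -/r; split; first lra.
by apply/negP; rewrite -leNgt; rewrite distrC in d; lra.
Qed.

(** The slot [a = 0] is empty, so its points are attributed to the slot [a = 1];
    this is why the bound is [2 ^- M] on both sides of the corner. *)
Lemma whitney_subcube_slot m M (t : R) : (m < M)%N ->
  exists a, [/\ (a < 2 ^ (M - m))%N, minn a 1 = 1%N &
    `|t - (grid_floor m t + a%:R * 2 ^- M)| <= 2 ^- M].
Proof.
move=> mM; have s0 := exp2V_gt0 M : 0 < 2 ^- M :> R.
have /andP[t1 t2] := grid_floor_itv m t.
set u := t - grid_floor m t; have u0 : 0 <= u by rewrite /u; lra.
have us : u < 2 ^- m by rewrite /u; lra.
have /andP[a1 a2] := truncn_itv (divr_ge0 u0 (ltW s0)).
set a0 := Num.truncn _ in a1 a2.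
rewrite ler_pdivlMr// in a1; rewrite ltr_pdivrMr// -natr1 mulrDl mul1r in a2.
have gt1 : (1 < 2 ^ (M - m))%N by rewrite -{1}(expn0 2) ltn_exp2l// subn_gt0.
have am : (a0 < 2 ^ (M - m))%N.
  rewrite -(ltr_nat R) natrX -(ltr_pM2r s0) -exp2V_split ?(ltnW mM)//.
  exact: le_lt_trans us.
have tu (v : R) : t - (grid_floor m t + v) = u - v by rewrite /u opprD addrA.
exists (maxn a0 1); split.
- by rewrite gtn_max am.
- by apply/minn_idPr; rewrite leq_max leqnn orbT.
rewrite tu; case: (posnP a0) => [a00|a0p].
  rewrite a00 max0n mul1r; rewrite a00 mul0r in a2; rewrite ler_norml.
  by apply/andP; split; lra.
by rewrite (maxn_idPl a0p) ler_norml; apply/andP; split; lra.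
Qed.

Definition good_subcube M x k Q : Prop :=
  [/\ whitney_subcube Q, cube_set Q `<=` annulus x k & side Q = 2 ^- M].

(** A point at distance at least 42 sides from [E] lies in a cell of side [2 * 2 ^- M]
    whose points are at distance at least 40 sides from [E]; this cell is far, so the point
    lies in a Whitney cell of side larger than [2 ^- M]. The layer of generation [M] of this
    Whitney cell has a cube in the column of the point and one in its row. *)
Lemma good_subcube_shadow M x y k (r := 2 ^- k : R) :
  (0 < M)%N -> E x -> 11 / 20 * r <= `|y - x| -> `|y - x| <= 61 / 100 * r ->
  (forall e, E e -> 42 * 2 ^- M <= `|y - e|) ->
  (exists2 Q, good_subcube M x k Q & `|y.1 - (corner Q).1| <= 2 ^- M) /\
  (exists2 Q, good_subcube M x k Q & `|y.2 - (corner Q).2| <= 2 ^- M).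
Proof.
move=> M0 Ex y1 y2 far; have s0 := exp2V_gt0 M : 0 < 2 ^- M :> R.
have fy : far_cell M.-1 y.
  move=> z zy e Ee; have yz := same_cell_dist zy; rewrite distrC in yz.
  have tri := ler_normD (y - z) (z - e); rewrite subrKA in tri.
  have eM : 2 ^- M.-1 = 2 * 2 ^- M :> R by rewrite exp2VS prednK.
  by rewrite eM in yz *; have := far e Ee; lra.
have [m mM [fm nm]] := whitney_cell_exists fy.
have {}mM : (m < M)%N by rewrite -(prednK M0) ltnS.
have one : (1 < 2 ^ (M - m))%N by rewrite -{1}(expn0 2) ltn_exp2l// subn_gt0.
have good a b : (a < 2 ^ (M - m))%N -> (b < 2 ^ (M - m))%N -> minn a b = 1%N ->
    exists2 Q, good_subcube M x k Q & corner Q = offset_corner m M y a b.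
  move=> am bm ab; exists (Cube (offset_corner m M y a b) s0) => //; split => //.
    by exists m, M, y, a, b.
  exact: (@whitney_subcube_annulus m M y a b).
split.
  have [a [am a1 ta]] := whitney_subcube_slot y.1 mM.
  by have [Q gQ cQ] := good a 1%N am one a1; exists Q; rewrite // cQ.
have [b [bm b1 tb]] := whitney_subcube_slot y.2 mM.
have [|Q gQ cQ] := good 1%N b one bm; first by rewrite minnC.
by exists Q; rewrite // cQ.
Qed.

End whitney_cubes.

(** * Curves with small weighted length stay in place *)

Lemma card_le_or_covered (T : Type) (V : choiceType) (f : T -> V)
    (A : set T) (n : nat) :
  (`I_n #<= A)%card \/
  exists s : seq V, (size s < n)%N /\ forall a, A a -> f a \in s.
Proof.
suff [[s sn]|[s [us sn sA]]] :
    (exists s : seq V, (size s < n)%N /\ forall a, A a -> f a \in s) \/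
    exists s : seq V, [/\ uniq s, size s = n &
                        forall v, v \in s -> exists2 a, A a & f a = v].
- by right; exists s.
- left; apply/pcard_surjP; exists (fun a => index (f a) s) => i /= iI.
  case: s => [|v0 s] in us sn sA *; first by rewrite -sn in iI.
  have [|a Aa fa] := sA (nth v0 (v0 :: s) i); first by rewrite mem_nth ?sn.
  by exists a => //; rewrite fa index_uniq ?sn.
elim: n => [|n [[s [sn As]]|[s [us sn sA]]]]; first by right; exists [::].
  by left; exists s; split => //; rewrite ltnS ltnW.
have [As|] := pselect (forall a, A a -> f a \in s).
  by left; exists s; rewrite sn ltnSn.
move=> /existsNP[a /not_implyP[Aa /negP fas]]; right; exists (f a :: s); split.
- by rewrite /= fas.
- by rewrite /= sn.
- by move=> v; rewrite inE => /predU1P[->|/sA//]; exists a.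
Qed.

Section curves_near_the_boundary.
Context {R : realType}.
Local Notation mu := (@lebesgue_measure R).
Variables (Omega : set (R * R)) (p C : R) (c : R -> R * R) (z1 z2 : R * R).
Hypothesis p12 : 1 < p < 2.
Hypothesis C0 : 0 < C.
Hypothesis E0 : boundary Omega !=set0.
Hypothesis rc : rectifiable_curve c (~` Omega) z1 z2.
Hypothesis lin : (line_integral c (dist_weight Omega p)
         <= (C * enorm (z1 - z2) `^ (2 - p))%:E)%E.

(** The weight is at least [D `^ (1 - p)] within distance [D] of the boundary, and the
    integral is at most [C * D `^ (2 - p)]: the exponents differ by one, whatever [p] is. *)
Lemma near_length_le (D : R) : 0 < D -> enorm (z1 - z2) <= D ->
  (mu (near_params Omega c D) <= (C * D)%:E)%E.
Proof.
move=> D0 zD; have /andP[p1 p2] := p12.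
have [cc _ _ _ lc] := rc.
have w0 : 0 < D `^ (1 - p) by rewrite powR_gt0.
have /le_trans/(_ lin) := line_integral_ge p1 E0 cc lc D.
have : C * enorm (z1 - z2) `^ (2 - p) <= D `^ (1 - p) * (C * D).
  have -> : D `^ (1 - p) * (C * D) = C * D `^ (2 - p).
    have -> : 2 - p = (1 - p) + 1 by ring.
    rewrite (@powRD _ D (1 - p) 1) ?(gt_eqF D0) ?implybT//.
    by rewrite (powRr1 (ltW D0)) mulrCA.
  rewrite ler_pM2l//; apply: ge0_ler_powR; rewrite ?nnegrE ?enorm_ge0//.
    by rewrite subr_ge0 ltW.
  exact: ltW.
rewrite -lee_fin => h1 h2; have := le_trans h2 h1.
by rewrite EFinM lee_pmul2l// lte_fin.
Qed.

(** Were the curve to leave the ball, its distance to [z1] would take all values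
    between [0] and [rho]. It takes few of them while the curve is within [D] of the boundary,
    since that part of the curve is short and the distance is a 1-Lipschitz function of the
    arc length; the others lie in the short intervals around the entries of [l]. *)
Lemma curve_stays_near (D rho s : R) (l : seq R) :
  0 < D -> enorm (z1 - z2) <= D -> 0 <= s ->
  (forall y, ~ Omega y -> `|y - z1| <= rho -> D < dist_set y (boundary Omega) ->
     exists2 u, u \in l & `| `|y - z1| - u| <= s) ->
  C * D + (size l)%:R * (2 * s) < rho ->
  forall t, 0 <= t <= 1 -> `|c t - z1| < rho.
Proof.
move=> D0 zD s0 cov lt_rho t /andP[t0 t1]; rewrite ltNge; apply/negP => rhot.
have [cc cK c0 c1 lc] := rc.
have rho0 : 0 <= rho.
  have : 0 <= (size l)%:R * (2 * s) by rewrite !mulr_ge0.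
  have : 0 <= C * D by rewrite mulr_ge0 ?ltW.
  lra.
pose g u := `|c u - z1|.
have gc : {within `[0, t], continuous g}.
  have : {within `[0, t], continuous c}.
    apply: continuous_subspaceW cc => u /=; rewrite !in_itv/= => /andP[-> ut].
    exact: le_trans ut t1.
  move=> cc' u; apply: cvg_norm; apply: cvgB; [exact: cc'|exact: cvg_cst].
pose f s := `|arc_length_param c s - z1|.
have : ((rho - 0)%:E <=
    mu (f @` near_params Omega c D) + ((size l)%:R * (2 * s))%:E)%E.
  apply: lebesgue_outer_cover => // v /andP[v0 vrho].
  have [u] : exists2 u, u \in `[0, t] & g u = v.
    apply: IVT => //; rewrite /g c0 subrr normr0.
    rewrite (min_idPl _) ?(max_idPr _) ?v0 ?normr_ge0//.
    exact: le_trans rhot.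
  rewrite in_itv/= => /andP[u0 ut] gu.
  have u1 := le_trans ut t1.
  have [near|far] := leP (dist_set (c u) (boundary Omega)) D; [left|right].
    exists (fine (curve_length c 0 u)); last by rewrite /f arc_length_paramK.
    split; last by rewrite arc_length_paramK.
    apply/andP; split; first by rewrite fine_ge0// curve_length_ge0.
    exact: length_nondecreasing.
  rewrite -gu; apply: cov => //; last by rewrite -[X in X <= _]/(g u) gu.
  by apply: cK; exists u => //=; rewrite in_itv/= u0.
have flip : (mu (f @` near_params Omega c D) <= mu (near_params Omega c D))%E.
  apply: lebesgue_outer_lipschitz => a b [/andP[a0 aL] _] [/andP[b0 bL] _].
  apply: le_trans (arc_length_param_lipschitz cc lc a0 aL b0 bL).
  apply: le_trans (le_normr_enorm _).
  rewrite /f; apply: le_trans (ler_dist_dist _ _) _.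
  by rewrite opprB addrA subrK.
rewrite subr0 => h; have := le_trans h (leeD2r _ (le_trans flip (near_length_le D0 zD))).
by rewrite -EFinD lee_fin; lra.
Qed.

(** The whole arc of length [D = |z1 - z2|] that starts at the boundary point [z1]
    lies within [D] of the boundary. *)
Lemma curve_constant_ge1 : boundary Omega z1 -> z1 != z2 -> 1 <= C.
Proof.
move=> Ez1 z12; have [cc cK c0 c1 lc] := rc.
set D := enorm (z1 - z2).
have D0 : 0 < D.
  by apply: lt_le_trans (le_normr_enorm _); rewrite normr_gt0 subr_eq0.
have DL : D <= fine (curve_length c 0 1).
  have := dist_le_length c ler01; rewrite c0 c1 enorm_distC.
  by rewrite (curve_length_initial lc ler01 (lexx 1)) lee_fin.
have sub : `[0, D]%classic `<=` near_params Omega c D.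
  move=> s /=; rewrite in_itv/= => /andP[s0 sD]; split.
    by rewrite s0 (le_trans sD).
  apply: le_trans (dist_set_le _ Ez1) _; apply: (le_trans _ sD).
  have g0 : arc_length_param c 0 = z1.
    by have := arc_length_paramK lc (lexx 0) ler01; rewrite curve_lengthxx c0.
  have sL := le_trans sD DL; have L0 := le_trans (ltW D0) DL.
  rewrite -g0; apply: le_trans (arc_length_param_lipschitz cc lc s0 sL (lexx 0) L0) _.
  by rewrite subr0 ger0_norm.
have := le_trans (le_lebesgue_outer sub) (near_length_le D0 (lexx D)).
rewrite lebesgue_measure_itv/= lte_fin D0 oppr0 adde0 lee_fin.
by rewrite -[leLHS]mul1r ler_pM2r.
Qed.

End curves_near_the_boundary.

(** * Porosity at one scale *)

Section one_scale.
Context {R : realType}.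

Lemma boundary_open_sub (Omega : set (R * R)) :
  open Omega -> boundary Omega `<=` ~` Omega.
Proof. by move=> oO z [_]; rewrite ((interior_id _).1 oO). Qed.

Lemma lipschitz_segment_connected (h : R -> R * R) (a b : R) :
  (forall u v, `|h u - h v| <= `|u - v|) -> connected (h @` `[a, b]).
Proof.
move=> hl; apply: connected_continuous_connected; first exact: segment_connected.
apply: continuous_subspaceT => u; apply/cvgrPdist_lt => e e0; near=> v.
apply: le_lt_trans (hl _ _) _; near: v.
by apply: cvgr_dist_lt.
Unshelve. all: by end_near. Qed.

(* The scale is [r], the side of the cubes is [s]. The radii between [56 / 100 r]
   and [60 / 100 r] leave room [r / 100] around the square in the annulus treated by
   [good_subcube_shadow]. As [C * s <= r / 50000], the length [128 C s] spent near the
   boundary and the length [4 C s] shadowed by the cubes add up to less than [r / 200]. *)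
Variables (Omega : set (R * R)) (p C : R) (x w1 : R * R) (k M : nat).
Let r : R := 2 ^- k.
Let s : R := 2 ^- M.
Let E := boundary Omega.
Hypothesis oO : open Omega.
Hypothesis cO : connected Omega.
Hypothesis p12 : 1 < p < 2.
Hypothesis C1 : 1 <= C.
Hypothesis cond : curve_condition Omega p C.
Hypothesis Ex : E x.
Hypothesis M0 : (0 < M)%N.
Hypothesis s_small : 100 * (100 * (C * s)) <= r / 5.
Hypothesis Ow1 : Omega w1.
Hypothesis w1far : 61 / 100 * r <= `|w1 - x|.

Let r0 : 0 < r. Proof. exact: exp2V_gt0. Qed.
Let s0 : 0 < s. Proof. exact: exp2V_gt0. Qed.

Section few_cubes.
Variable gs : seq (R * R).
Hypothesis gsC : (size gs)%:R <= C.
Hypothesis gsP : forall Q, good_subcube E M x k Q -> corner Q \in gs.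

(** The possible max-distances to [z] of the points shadowed by the cubes with lower
    left corners [gs]: the max-distance is attained by one of the two coordinates. *)
Definition shadow_radii z : seq R :=
  [seq `|g.1 - z.1| | g <- gs] ++ [seq `|g.2 - z.2| | g <- gs].

Lemma far_point_radius y z :
  11 / 20 * r <= `|y - x| -> `|y - x| <= 61 / 100 * r ->
  (forall e, E e -> 42 * s <= `|y - e|) ->
  exists2 u, u \in shadow_radii z & `| `|y - z| - u| <= s.
Proof.
move=> y1 y2 far; have [[Q1 g1 d1] [Q2 g2 d2]] := good_subcube_shadow M0 Ex y1 y2 far.
have near (a b c : R) : `|a - b| <= s -> `| `|a - c| - `|b - c| | <= s.
  by move=> ab; apply: le_trans (ler_dist_dist _ _) _; rewrite opprB addrA subrK.
rewrite (prod_normE (y - z)) /=.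
have [h|h] := leP `|y.1 - z.1| `|y.2 - z.2|.
  exists `|(corner Q2).2 - z.2|; last exact: near.
  by rewrite mem_cat; apply/orP; right; apply/mapP; exists (corner Q2) => //; exact: gsP.
exists `|(corner Q1).1 - z.1|; last exact: near.
by rewrite mem_cat; apply/orP; left; apply/mapP; exists (corner Q1) => //; exact: gsP.
Qed.

Lemma shadow_radii_size z : (size (shadow_radii z))%:R * (2 * s) <= 4 * (C * s).
Proof.
rewrite size_cat !size_map natrD.
have : (size gs)%:R * s <= C * s by rewrite ler_pM2r.
lra.
Qed.

(** A radius that fails is among those covered by [shadow_radii x], which have small
    total length. *)
Lemma near_square : exists t, [/\ 56 / 100 * r <= t, t <= 60 / 100 * r &
  forall w, `|w - x| = t -> exists e, E e /\ `|w - e| < 42 * s].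
Proof.
apply: contrapT => no.
have : ((60 / 100 * r - 56 / 100 * r)%:E <=
    lebesgue_measure (set0 : set R) + ((size (shadow_radii x))%:R * (2 * s))%:E)%E.
  apply: lebesgue_outer_cover; [exact: ltW| move: r0; lra|].
  move=> v /andP[v1 v2]; right; apply: contrapT => nu; apply: no; exists v; split => // w wv.
  apply: contrapT => ne; apply: nu; rewrite -wv; apply: far_point_radius.
  - by rewrite wv; move: r0; lra.
  - by rewrite wv; move: r0; lra.
  - by move=> e Ee; rewrite leNgt; apply/negP => h; apply: ne; exists e.
rewrite measure0 add0e lee_fin; have := shadow_radii_size x; move: s_small r0; lra.
Qed.

(** The curve from [e] to [e'] has endpoints at max-distance at most [85 s], hence at
    Euclidean distance at most [128 s]. A point of the curve farther than [128 s] from the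
    boundary is at max-distance more than [42 s] from it, so it is shadowed by a cube. *)
Lemma near_square_step (t d : R) w w' e e' :
  56 / 100 * r <= t -> t <= 60 / 100 * r -> 0 < d ->
  `|w - x| = t -> `|w - w'| <= s ->
  E e -> E e' -> `|w - e| < 42 * s -> `|w' - e'| < 42 * s ->
  chained (~` Omega `&` [set v | `|v - w| < r / 100]) d e e'.
Proof.
move=> t1 t2 d0 wt ww' Ee Ee' we we'.
have C0 : 0 < C by exact: lt_le_trans ltr01 C1.
have r0' := r0; have s0' := s0; have ss := s_small.
have E0 : E !=set0 by exists x.
have s_le : 100 * (100 * s) <= r / 5.
  apply: le_trans s_small; rewrite !ler_pM2l// -[leLHS]mul1r ler_pM2r//.
have [c [rc lin]] := cond (boundary_open_sub oO Ee) (boundary_open_sub oO Ee').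
have ee' : enorm (e - e') <= 128 * s.
  apply: le_trans (enorm_le_normr _) _.
  have h1 := ler_normD (e - w) (w - e'); rewrite subrKA in h1.
  have h2 := ler_normD (w - w') (w' - e'); rewrite subrKA in h2.
  by rewrite (distrC e w) in h1; lra.
have stay := @curve_stays_near _ Omega p C c e e' p12 C0 E0 rc lin
  (128 * s) (r / 200) s (shadow_radii e).
have {stay}stay : forall u, 0 <= u <= 1 -> `|c u - e| < r / 200.
  apply: stay => //; [lra|exact: ltW| |]; last first.
    by have := shadow_radii_size e; move: s_small; lra.
  move=> y _ ye far.
  have h1 := ler_normD (y - e) (e - w); rewrite subrKA (distrC e w) in h1.
  have h2 := ler_normD (y - w) (w - x); rewrite subrKA in h2.
  have h3 := ler_normD (w - y) (y - x); rewrite subrKA (distrC w y) in h3.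
  apply: far_point_radius; [lra|lra|].
  move=> f Ef; have := dist_set_le y Ef; have := enorm_le_normr (y - f); lra.
have [cc cK <- <- _] := rc.
apply: curve_chained => // _ [u u01 <-]; split.
  by apply: cK; exists u.
have c0 : c 0 = e by case: rc.
move: u01; rewrite /= in_itv/= => /stay h.
by have := ler_normD (c u - e) (e - w); rewrite subrKA (distrC e w); lra.
Qed.

(** The curves of [near_square_step] along the four sides of the square of radius [t]
    form a loop around [x] outside [Omega], while [Omega] has points near [x] and the
    point [w1] beyond the loop. *)
Lemma few_cubes_absurd : False.
Proof.
have r0' := r0; have s0' := s0; have ss := s_small.
have [t [t1 t2 near]] := near_square.
have /choice[zeta zetaP] : forall w, exists e, `|w - x| = t -> E e /\ `|w - e| < 42 * s.
  move=> w.
  have [/near[e He]|h] := eqVneq `|w - x| t; first by exists e.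
  by exists x => wt; rewrite wt eqxx in h.
have [w0 [Ow0 w0x]] : exists w0, Omega w0 /\ `|w0 - x| < r / 100.
  have [cx _] := Ex; have [|w0 [Ow0 bw0]] := cx (ball x (r / 100)).
    by apply: nbhsx_ballx; rewrite divr_gt0.
  by exists w0; split => //; rewrite distrC; move: bw0; rewrite -ball_normE.
(* The function [zeta] attaches to each point of the square a boundary point
   close to it. Along each side, parametrized by [h], these are chained together by
   connectedness of the side. *)
have side (h : R -> R * R) (U : set (R * R)) (d : R) : 0 < d ->
    (forall u v, `|h u - h v| <= `|u - v|) ->
    (forall u, - t <= u <= t -> `|h u - x| = t) ->
    (forall u v, - t <= u <= t -> `|v - h u| < r / 100 -> U v) ->
    forall u v, - t <= u <= t -> - t <= v <= t ->
    chained (~` Omega `&` [set v | `|v - x| < 61 / 100 * r] `&` U) d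
      (zeta (h u)) (zeta (h v)).
  move=> d0 hl hx hU u v ut vt.
  apply: (connected_local_relation (A := h @` `[- t, t])
      (P := fun a b =>
        chained (~` Omega `&` [set v | `|v - x| < 61 / 100 * r] `&` U) d
          (zeta a) (zeta b))).
  - exact: lipschitz_segment_connected.
  - by move=> a b c; exact: chained_trans.
  - have one a b : - t <= a <= t -> - t <= b <= t -> `|h a - h b| <= s ->
        chained (~` Omega `&` [set v | `|v - x| < 61 / 100 * r] `&` U) d
          (zeta (h a)) (zeta (h b)).
      move=> ta tb ab.
      have [Ea za] := zetaP _ (hx a ta); have [Eb zb] := zetaP _ (hx b tb).
      apply: chained_sub (near_square_step t1 t2 d0 (hx a ta) ab Ea Eb za zb).
      move=> z [Oz /= zh]; split; last exact: hU zh.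
      split => //=; have := ler_normD (z - h a) (h a - x); rewrite subrKA hx//; lra.
    move=> v0 [a /=]; rewrite in_itv/= => ta <-{v0}; exists s => // v1 [b /=].
    rewrite in_itv/= => tb <-{v1} ab.
    by split; apply: one => //; rewrite ?(distrC (h b)) ltW.
  - by exists u => //=; rewrite in_itv.
  - by exists v => //=; rewrite in_itv.
have t0 : 0 <= t by lra.
have tt : - t <= t <= t by apply/andP; split; lra.
have tt' : - t <= - t <= t by apply/andP; split; lra.
have sq (a b : R) : - t <= a <= t -> - t <= b <= t -> `|a| = t \/ `|b| = t ->
    `|((x.1 + a, x.2 + b) : R * R) - x| = t.
  move=> ta tb ab; rewrite prod_normE /= (addrC x.1) (addrC x.2) !addrK.
  have {}ta : `|a| <= t by rewrite ler_norml.
  have {}tb : `|b| <= t by rewrite ler_norml.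
  by case: ab => ->; [apply/max_idPl|apply/max_idPr].
have nt : `|t| = t by rewrite ger0_norm.
have [w0b1 w0b2 w0b3 w0b4] : [/\ w0.1 < x.1 + r / 100, x.1 - r / 100 < w0.1,
    w0.2 < x.2 + r / 100 & x.2 - r / 100 < w0.2].
  move: w0x; rewrite normr_pair_lt !ltr_norml /= => /andP[/andP[? ?] /andP[? ?]].
  by split; lra.
have box (v a : R * R) : `|v - a| < r / 100 ->
    [/\ v.1 < a.1 + r / 100, a.1 - r / 100 < v.1,
        v.2 < a.2 + r / 100 & a.2 - r / 100 < v.2].
  rewrite normr_pair_lt !ltr_norml /= => /andP[/andP[? ?] /andP[? ?]].
  by split; lra.
have hor (b u v : R) : `|((x.1 + u, x.2 + b) : R * R) - (x.1 + v, x.2 + b)| <= `|u - v|.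
  by rewrite normr_pair_le /= subrr normr0 normr_ge0 andbT opprD addrACA subrr add0r.
have ver (b u v : R) : `|((x.1 + b, x.2 + u) : R * R) - (x.1 + b, x.2 + v)| <= `|u - v|.
  by rewrite normr_pair_le /= subrr normr0 normr_ge0 /= opprD addrACA subrr add0r.
apply: (@loop_separates _ Omega x w0 w1
  (zeta (x.1 + t, x.2 + t)) (zeta (x.1 + - t, x.2 + t))
  (zeta (x.1 + - t, x.2 + - t)) (zeta (x.1 + t, x.2 + - t)) (61 / 100 * r))
  => // d d0; split.
- apply: (side (fun u => (x.1 + u, x.2 + t))) => //.
    by move=> u ut; apply: sq => //; right.
  by move=> u v ut /box[/= ? ? ? ?]; lra.
- apply: (side (fun u => (x.1 + - t, x.2 + u))) => //.
    by move=> u ut; apply: sq => //; left; rewrite normrN.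
  by move=> u v ut /box[/= ? ? ? ?]; lra.
- apply: (side (fun u => (x.1 + u, x.2 + - t))) => //.
    by move=> u ut; apply: sq => //; right; rewrite normrN.
  by move=> u v ut /box[/= ? ? ? ?]; lra.
- apply: (side (fun u => (x.1 + t, x.2 + u))) => //.
    by move=> u ut; apply: sq => //; left.
  by move=> u v ut /box[/= ? ? ? ?]; lra.
Qed.

End few_cubes.

(** If there are fewer than [truncn C + 1] good cubes, there are at most [C] of them. *)
Lemma porous_at_scale (alpha : R -> R) : alpha r <= s ->
  porous_scale (whitney_subcube E) alpha (fun _ => C) x k.
Proof.
move=> alphar; have C0 : 0 <= C by exact: le_trans ler01 C1.
have /andP[n1 n2] := truncn_itv C0.
exists (Num.truncn C).+1; split; first exact: ltW.
have [h|[gs [gsn gsP]]] := card_le_or_covered (@corner R)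
  (good_subcube E M x k) (Num.truncn C).+1.
  apply: card_le_trans h _; apply: subset_card_le => Q [D A sQ]; split => //.
  by rewrite sQ.
exfalso; apply: (few_cubes_absurd (gs := gs)) => //.
by apply: le_trans n1; rewrite ler_nat -ltnS.
Qed.

End one_scale.

(** * Porosity at all small scales *)

Section domains_of_the_plane.
Context {R : realType}.
Implicit Types (Omega : set (R * R)) (x z : R * R).

(** Otherwise [Omega] would be open and closed, and a line through a point of
    [Omega] and a point of its complement would be disconnected. *)
Lemma boundary_nonempty Omega : open Omega -> Omega !=set0 -> ~` Omega !=set0 ->
  boundary Omega !=set0.
Proof.
move=> oO [u Ou] [v nOv]; apply: contrapT => E0.
have cO : closed Omega.
  move=> z cz; apply: contrapT => nOz; apply: E0; exists z; split => //.
  by rewrite ((interior_id _).1 oO).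
pose h (t : R) : R * R := u + t *: (v - u).
have hc : continuous h.
  by move=> t; apply: cvgD; [exact: cvg_cst|apply: cvgZr_tmp; exact: cvg_id].
have cR : connected [set: R] by apply/connected_intervalP => a b _ _ c _.
have : h @^-1` Omega = [set: R].
  apply: cR.
  - by exists 0; rewrite /= /h scale0r addr0.
  - by exists (h @^-1` Omega); rewrite ?setTI//; apply: open_comp => // t _; exact: hc.
  - by exists (h @^-1` Omega); rewrite ?setTI//; apply: closed_comp => // t _; exact: hc.
move=> /seteqP[_ /(_ 1 I)]; rewrite /= /h scale1r addrC subrK.
exact: nOv.
Qed.

Lemma bounded_set_bound Omega : bounded_set Omega ->
  exists2 B : R, 0 <= B & forall z, Omega z -> `|z| <= B.
Proof.
move=> [N [_ HN]]; exists (`|N| + 1); first by rewrite addr_ge0.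
apply: HN; have := ler_norm N; lra.
Qed.

Lemma compact_boundary Omega : bounded_set Omega -> compact (boundary Omega).
Proof.
move=> /bounded_set_bound[B B0 HB].
have cB : compact (`[- B, B] `*` `[- B, B] : set (R * R)).
  by apply: compact_setX; exact: segment_compact.
apply: subclosed_compact (@closed_boundary _ _) cB _ => z [cz _].
have zB : `|z| <= B.
  rewrite leNgt; apply/negP => Bz.
  have [|w [Ow]] := cz (ball z (`|z| - B)); first by apply: nbhsx_ballx; rewrite subr_gt0.
  rewrite -ball_normE /= => zw; have := HB w Ow; have := ler_normD (z - w) w.
  by rewrite subrK; lra.
by move: zB; rewrite normr_pair_le !ler_norml => /andP[z1 z2]; split; rewrite /= in_itv.
Qed.

(** Two distinct points of [Omega] suffice: every [x] is far from one of them. The bound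
    [e] is uniform in [x], which yields one [k0] for all boundary points. *)
Lemma far_point_of_open Omega : open Omega -> Omega !=set0 ->
  exists2 e : R, 0 < e & forall x, exists2 w, Omega w & e <= `|w - x|.
Proof.
move=> oO [u Ou]; have : nbhs u Omega by apply: open_nbhs_nbhs.
move=> /nbhs_ballP[e /= e0 be].
have e4 : 0 < e / 4 by rewrite divr_gt0.
pose v : R * R := (u.1 + e / 2, u.2).
have uv : `|u - v| <= e / 2 /\ e / 2 <= `|u - v|.
  rewrite prod_normE /= subrr normr0 opprD addNKr normrN (max_idPl _)//.
  by rewrite ger0_norm; [split|lra].
have Ov : Omega v.
  by apply: be; rewrite -ball_normE /=; case: uv => h _; apply: le_lt_trans h _; lra.
exists (e / 4) => // x; have [h|h] := leP (e / 4) `|u - x|; first by exists u.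
exists v => //; have := ler_normD (u - x) (x - v); rewrite subrKA (distrC x v).
by case: uv; lra.
Qed.

Lemma exists_exp2V_lt (e : R) : 0 < e -> exists n, 2 ^- n < e.
Proof.
move=> e0; exists (Num.truncn e^-1).+1.
rewrite -[ltRHS]invrK ltf_pV2 ?posrE ?exprn_gt0 ?invr_gt0//.
apply: (lt_le_trans (truncnS_gt _)).
by rewrite -natrX ler_nat ltnW// ltn_expl.
Qed.

Lemma exp2V_anti m n : (m <= n)%N -> 2 ^- n <= 2 ^- m :> R.
Proof.
move=> mn; rewrite lef_pV2 ?posrE ?exprn_gt0//.
by rewrite ler_weXn2l// ler1n.
Qed.

Lemma exp2V_approx (e : R) : 0 < e <= 1 -> exists q, e <= 2 ^- q < 2 * e.
Proof.
move=> /andP[e0 e1]; have e20 : 0 < 2 * e by rewrite mulr_gt0.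
case: (ex_minnP (exists_exp2V_lt e20)) => q qe min; exists q; rewrite qe andbT.
case: q => [|q] in qe min *; first by rewrite expr0 invr1.
have : 2 * e <= 2 ^- q.
  by rewrite leNgt; apply/negP => /min; rewrite ltnn.
by rewrite exp2VS; lra.
Qed.

End domains_of_the_plane.

Lemma eventually_porous (R : realType) (D : set (@cube R)) alpha lambda x
    (k0 j : nat) :
  (0 < k0)%N -> (forall k, (k0 <= k)%N -> porous_scale D alpha lambda x k) ->
  (2 * k0 <= j)%N ->
  2^-1 < (porosity_sum D alpha lambda x j)%:R / j%:R :> R.
Proof.
move=> k00 por jk; have j0 : (0 < j)%N by lia.
have : (j.+1 - k0 <= porosity_sum D alpha lambda x j)%N.
  rewrite /porosity_sum (big_cat_nat (n := k0))//=; last by lia.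
  apply: leq_trans (leq_addl _ _).
  rewrite -[leqLHS]muln1 -sum_nat_const_nat !big_nat; apply: leq_sum => k /andP[kk _].
  by rewrite /chi; case: asboolP => // -[]; exact: por.
move=> h; rewrite ltr_pdivlMr ?ltr0n// mulrC ltr_pdivrMr// -natrM ltr_nat.
by lia.
Qed.

Unset Implicit Arguments.

Theorem theorem3p2 (R : realType) :
  exists C' C'' : R, [/\ 0 < C', 0 < C'' &
    forall (p : R) (Omega : set (R * R)) (C : R),
      1 < p < 2 ->
      bounded_set Omega ->
      simply_connected Omega ->
      sobolev_extension_domain Omega p ->
      0 < C ->
      curve_condition Omega p C ->
      weakly_mean_porous (boundary Omega)
        (fun t : R => C'' / C * t) (fun _ : nat => C' * C)].
Proof.
(* The factor [1 / 100000] makes [C * s], which is less than [2 * kappa * r], smaller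
   than [r / 50000]. *)
pose kappa : R := (100 * 100 * 10)^-1.
have kappa0 : 0 < kappa by rewrite invr_gt0 !mulr_gt0.
exists 1, kappa; split => // p Omega C p12 bO _ [[ne oO cO] _] C0 cond.
have [B B0 HB] := bounded_set_bound bO.
have outside z : B < `|z| -> ~ Omega z by move=> Bz /HB; rewrite leNgt Bz.
(* The complement is unbounded, so it has points different from a given one. *)
have out1 (t : R) : B < t -> ~ Omega (t, 0).
  move=> Bt; apply: outside; rewrite prod_normE /= normr0 lt_max.
  by rewrite (lt_le_trans Bt (ler_norm _)).
have E0 : boundary Omega !=set0.
  apply: boundary_nonempty => //; exists (B + 1, 0); apply: out1; lra.
have C1 : 1 <= C.
  have [z Ez] := E0; pose w : R * R := (B + `|z.1| + 1, 0).
  have nOw : ~ Omega w by apply: out1; have := normr_ge0 z.1; lra.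
  have [c [rc lin]] := cond z w (boundary_open_sub oO Ez) nOw.
  apply: (curve_constant_ge1 p12 C0 E0 rc lin Ez).
  apply/eqP => zw; have : z.1 = B + `|z.1| + 1 by rewrite {1}zw.
  have := ler_norm z.1; lra.
have kC0 : 0 < kappa / C by rewrite divr_gt0.
have kC1 : kappa / C <= 1.
  rewrite ler_pdivrMr// mul1r; apply: le_trans C1.
  by rewrite invf_le1 ?mulr_gt0//; lra.
split; first exact: compact_boundary.
  split.
  - move=> t /andP[t0 t1]; rewrite mulr_gt0//=; apply: le_lt_trans t1.
    by rewrite -[leRHS]mul1r ler_pM2r.
  - by apply: continuous_subspaceT; exact: mulrl_continuous.
  - move=> a b a0 ab b1; rewrite !mulfK ?gt_eqF//; exact: lt_le_trans ab.
have [e e0 He] := far_point_of_open oO ne.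
have [k0 k0e] := exists_exp2V_lt e0.
(* The side of the cubes is the first power of two above [kappa / C * r]. *)
have [q /andP[q1 q2]] : exists q, kappa / C <= 2 ^- q < 2 * (kappa / C).
  by apply: exp2V_approx; rewrite kC0.
exists (whitney_subcube (boundary Omega)), (2 * k0.+1)%N; split => //.
- exact: trivIset_whitney_subcube.
- exact: whitney_subcube_avoids.
move=> x j Ex jk; apply: (eventually_porous (k0 := k0.+1)) => // k kk.
have [w1 Ow1 w1x] := He x.
have r0 : 0 < 2 ^- k :> R by exact: exp2V_gt0.
have sE : 2 ^- (k + q) = 2 ^- q * 2 ^- k :> R by rewrite exprD invfM mulrC.
rewrite mul1r.
apply: (porous_at_scale (p := p) (w1 := w1) (M := k + q)) => //.
- by rewrite addn_gt0 (leq_trans _ kk).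
- rewrite sE; have : C * 2 ^- q <= 2 * kappa.
    by rewrite mulrC -ler_pdivlMr// -mulrA ltW.
  have : kappa * (100 * 100 * 10) = 1 by rewrite mulVf// !mulf_neq0.
  move=> h1 h2; rewrite [C * _]mulrA.
  have : C * 2 ^- q * 2 ^- k <= 2 * kappa * 2 ^- k by rewrite ler_pM2r.
  move: (C * _ * _) => y h3; rewrite !(mulrA 100).
  have h4 : 2 * kappa * 2 ^- k * (100 * 100) = 2 ^- k / 5.
    transitivity (kappa * (100 * 100 * 10) * (2 ^- k / 5)); last by rewrite h1 mul1r.
    by move: (kappa) (2 ^- k) => a b; field.
  by rewrite -h4 [leRHS]mulrC ler_pM2l// !mulr_gt0.
- apply: le_trans w1x; have : 2 ^- k <= 2 ^- k0 :> R by apply: exp2V_anti; exact: ltnW.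
  by move: r0 k0e; lra.
- by rewrite sE ler_pM2r.
Qed.
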